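(* Let $m\ge 1$, let $\mathcal T$ be an ideal triangulation (satisfying the conditions in the context) of a marked surface $\mathbb S$ with $d$ marked points, and let $Q=Q_{\mathcal T,m}$ be the associated quiver. (a) The quotient of the space of primitive potentials on $Q$ by the action of the group of those right-equivalences that preserve this space is isomorphic to $(\mathbf k^{\times})^{(m-1)d+1}$. (b) Let $\pi_{\mathrm{prim}}$ denote the projection of the space of generic potentials on $Q$ onto the space of primitive potentials. For any right-equivalence $\varphi$ and any generic potential $W$ on $Q$, $$\pi_{\mathrm{prim}}(\varphi(W))=\pi_{\mathrm{prim}}\bigl(\varphi(\pi_{\mathrm{prim}}(W))\bigr).$$
   Context: **Surface and triangulation.** $\mathbb S$ is a compact oriented surface of genus $g$ with $d>0$ marked points (punctures), $2-2g-d<0$. An ideal arc is a non-selfintersecting curve with endpoints at marked points, up to isotopy relative to the marked points, which is not a contractible loop on the surface minus the marked points. An ideal triangulation $\mathcal T$ is a maximal collection of pairwise different non-intersecting ideal arcs; its complement is a union of triangles. It is assumed that no arc of $\mathcal T$ has coinciding endpoints and every marked point has valence at least $3$. **Quiver $Q_{\mathcal T,m}$.** Let $\Delta=\{(x,y,z)\in\mathbb R_{\ge0}^3: x+y+z=m+1\}$, oriented. The standard quiver in $\Delta$ has as vertices the integral points of $\Delta$ other than its three corners. For each triple of non-negative integers $(a,b,c)$ with $a+b+c=m-1$, take the ''black'' triangle with vertices $(a,b+1,c+1),(a+1,b,c+1),(a+1,b+1,c)$ and orient its three edges counterclockwise; these are the arrows. $Q_{\mathcal T,m}$, embedded in $\mathbb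 S$, is obtained by identifying every triangle of $\mathcal T$ with $\Delta$ (orientation-preservingly, compatibly along common edges) and gluing the copies of the standard quiver, identifying the $m$ vertices on each edge shared by two triangles. **Potentials.** $\mathbf k$ is a field of characteristic zero, $Q=(Q_0,Q_1,s,t)$ a finite quiver, $R=\bigoplus_{i\in Q_0}\mathbf k e_i$, $A$ the span of $Q_1$, with $R$-bimodule structure $e_i\alpha=\delta_{i,t(\alpha)}\alpha$, $\alpha e_j=\delta_{s(\alpha),j}\alpha$ (so in a path $\alpha_1\cdots\alpha_n$ the arrow $\alpha_n$ is traversed first and $s(\alpha_i)=t(\alpha_{i+1})$). $R\langle\langle Q\rangle\rangle$ is the path algebra completed with respect to path length. A potential is a possibly infinite $\mathbf k$-linear combination of cyclic paths, considered up to cyclic shift ($\alpha_1\cdots\alpha_n\leftrightarrow\alpha_n\alpha_1\cdots\alpha_{n-1}$). A right-equivalence is an automorphism $\varphi$ of $R\langle\langle Q\rangle\rangle$ with $\varphi|_R=\mathrm{id}$ (determined by $\varphi|_A=\varphi^{\mathrm{diag}}+\varphi^{\mathrm{un}}$, with $\varphi^{\mathrm{diag}}:A\to A$ an $R$-bimodule isomorphism and $\varphi^{\mathrm{un}}$ an $R$-bimodule map from $A$ to the span of paths of length $\ge2$); it acts on potentials, and $W,W'$ are right-equivalent if $\varphi(W)=W'$ for some right-equivalence $\varphi$. **Primitive and generic potentials.** A chord of a cycle $\alpha_1\cdots\alpha_n$ is a triple $(\beta,i,j)$ with $\beta\in Q_1$, $i\ne j$, $t(\beta)=t(\alpha_i)$,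 $s(\beta)=s(\alpha_j)$; a cycle without chords is chordless. A potential is primitive if it is a linear combination of chordless cycles in which every chordless cycle has nonzero coefficient. The primitive part $\pi_{\mathrm{prim}}(W)$ of a potential $W$ is its projection to the span of chordless cycles (discarding all other cycles). $W$ is generic if $\pi_{\mathrm{prim}}(W)$ is a primitive potential. *)

(* Defs.v *)
From HB Require Import structures.
From mathcomp Require Import all_boot all_order all_algebra.
From mathcomp Require Import boolp zify.

Set Implicit Arguments.
Unset Strict Implicit.
Unset Printing Implicit Defensive.

Import GRing.Theory.
Local Open Scope ring_scope.
Local Open Scope quotient_scope.

Record quiver := Quiver {
  vert : finType;
  arrow : finType;
  src : arrow -> vert;
  tgt : arrow -> vert }.

Section Paths.
Variable Q : quiver.
Implicit Types (i : vert Q) (w : seq (arrow Q)).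

(* Words are read as compositions: in a1 ... an the arrow an is traversed     *)
(* first, so src a_l = tgt a_(l+1); i is the target of the word.              *)
Fixpoint chain i w : bool :=
  if w is a :: w' then (tgt a == i) && chain (src a) w' else true.

Definition chain_src i w : vert Q := last i (map (@src Q) w).

Lemma chain_cat i w1 w2 :
  chain i (w1 ++ w2) = chain i w1 && chain (chain_src i w1) w2.
Proof.
by elim: w1 i => [|a w1 IH] i //=; rewrite IH andbA.
Qed.

Lemma chain_src_cat i w1 w2 :
  chain_src i (w1 ++ w2) = chain_src (chain_src i w1) w2.
Proof. by rewrite /chain_src map_cat last_cat. Qed.

(* The pair (i, [::]) is the trivial path at i.                               *)
Definition qpath := {p : vert Q * seq (arrow Q) | chain p.1 p.2}.
Definition ptgt (p : qpath) : vert Q := (val p).1.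
Definition pword (p : qpath) : seq (arrow Q) := (val p).2.
Definition psrc (p : qpath) : vert Q := chain_src (ptgt p) (pword p).

Lemma triv_subproof i : chain i [::].
Proof. by []. Qed.
Definition triv_path i : qpath := Sub (i, [::]) (triv_subproof i).

Lemma ptake_subproof n (p : qpath) :
  let q := (ptgt p, take n (pword p)) in chain q.1 q.2.
Proof.
by move: (valP p); rewrite /= -{1}[X in chain _ X](cat_take_drop n) chain_cat => /andP[].
Qed.
Definition ptake n (p : qpath) : qpath := Sub (_, _) (ptake_subproof n p).

Lemma pdrop_subproof n (p : qpath) :
  let q := (psrc (ptake n p), drop n (pword p)) in chain q.1 q.2.
Proof.
by move: (valP p); rewrite /= -[X in chain _ X](cat_take_drop n) chain_cat => /andP[].
Qed.
Definition pdrop n (p : qpath) : qpath := Sub (_, _) (pdrop_subproof n p).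

Lemma qpath_eq (p q : qpath) : ptgt p = ptgt q -> pword p = pword q -> p = q.
Proof.
move=> e1 e2; apply: val_inj; move: e1 e2; rewrite /ptgt /pword.
by case: (val p) (val q) => [? ?] [? ?] /= -> ->.
Qed.

Lemma psrc_drop n p : psrc (pdrop n p) = psrc p.
Proof.
rewrite /psrc /= /psrc /= -chain_src_cat /pword /=.
by rewrite cat_take_drop.
Qed.

Lemma ptake_take n l p : (n <= l)%N -> ptake n (ptake l p) = ptake n p.
Proof. by move=> nl; apply: qpath_eq; rewrite // /pword /= take_takel. Qed.

Lemma pdrop_take n l p : pdrop n (ptake (n + l) p) = ptake l (pdrop n p).
Proof.
apply: qpath_eq => /=; rewrite /ptgt /= ?ptake_take ?leq_addr //.
by rewrite /pword /= take_drop addnC.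
Qed.

Lemma pdrop_drop n l p : pdrop l (pdrop n p) = pdrop (n + l) p.
Proof.
apply: qpath_eq => /=; last by rewrite /pword /= drop_drop addnC.
by rewrite /ptgt /= -pdrop_take psrc_drop.
Qed.

Lemma ptake_over n p : (size (pword p) <= n)%N -> ptake n p = p.
Proof. by move=> np; apply: qpath_eq; rewrite // /pword /= take_oversize. Qed.

Lemma pdrop0 p : pdrop 0 p = p.
Proof.
by apply: qpath_eq; rewrite /ptgt /pword /= /psrc /= ?/pword /= ?take0 ?drop0.
Qed.

End Paths.

Definition cpath_alg (k : fieldType) (Q : quiver) : Type := qpath Q -> k.

Section PathAlgebra.
Variables (k : fieldType) (Q : quiver).
Local Notation A := (cpath_alg k Q).
Implicit Types f g h : A.

HB.instance Definition _ := Choice.copy A (qpath Q -> k).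

Definition series_add f g : A := fun p => f p + g p.
Definition series_opp f : A := fun p => - f p.
Definition series_scale (a : k) f : A := fun p => a * f p.

Lemma series_addA : associative series_add.
Proof. by move=> f g h; apply: funext => p; rewrite /series_add addrA. Qed.
Lemma series_addC : commutative series_add.
Proof. by move=> f g; apply: funext => p; rewrite /series_add addrC. Qed.
Lemma series_add0 : left_id (fun=> 0) series_add.
Proof. by move=> f; apply: funext => p; rewrite /series_add add0r. Qed.
Lemma series_addN : left_inverse (fun=> 0) series_opp series_add.
Proof. by move=> f; apply: funext => p; rewrite /series_add addNr. Qed.

HB.instance Definition _ :=
  GRing.isZmodule.Build A series_addA series_addC series_add0 series_addN.

Lemma series_scaleA a b f :
  series_scale a (series_scale b f) = series_scale (a * b) f.
Proof. by apply: funext => p; rewrite /series_scale mulrA. Qed.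
Lemma series_scale1 : left_id 1 series_scale.
Proof. by move=> f; apply: funext => p; rewrite /series_scale mul1r. Qed.
Lemma series_scaleDr : right_distributive series_scale +%R.
Proof. by move=> a f g; apply: funext => p; apply: mulrDr. Qed.
Lemma series_scaleDl f :
  {morph series_scale^~ f : a b / a + b}.
Proof. by move=> a b; apply: funext => p; apply: mulrDl. Qed.

HB.instance Definition _ := GRing.Zmodule_isLmodule.Build k A
  series_scaleA series_scale1 series_scaleDr series_scaleDl.

Definition idem (i : vert Q) : A := fun p => (p == triv_path i)%:R.

Definition series_one : A := fun p => (pword p == [::])%:R.

Definition series_mul f g : A := fun p =>
  \sum_(n < (size (pword p)).+1) f (ptake n p) * g (pdrop n p).

Lemma series_mulA : associative series_mul.
Proof.
move=> f g h; apply: funext => p; rewrite /series_mul.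
set N := size (pword p).
pose F (j l : nat) :=
  f (ptake j p) * g (ptake l (pdrop j p)) * h (pdrop (j + l) p).
transitivity (\sum_(j < N.+1) \sum_(i < N.+1 | (j <= i)%N) F j (i - j)%N).
  apply: eq_bigr => j _.
  have -> : size (pword (pdrop j p)) = (N - j)%N by rewrite size_drop.
  have jN : (j <= N)%N := ltn_ord j.
  rewrite mulr_sumr -subSn // -(big_mkord xpredT (fun l =>
    f (ptake j p) * (g (ptake l (pdrop j p)) * h (pdrop l (pdrop j p))))).
  rewrite -(big_mkord (fun i => (j <= i)%N) (fun i => F j (i - j)%N)).
  rewrite [RHS](big_cat_nat (n := j)) //=; last exact: leqW.
  rewrite [X in _ = X + _]big1_seq ?add0r; last first.
    by move=> i /andP[ji]; rewrite mem_index_iota /= ltnNge ji.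
  rewrite -[X in index_iota X N.+1](add0n j) big_addn.
  apply: eq_big => [l|l _]; first by rewrite leq_addl.
  by rewrite /F addnK pdrop_drop mulrA.
rewrite (exchange_big_dep xpredT) //=; apply: eq_bigr => i _.
have -> : size (pword (ptake i p)) = i by rewrite size_takel // -ltnS.
rewrite mulr_suml (big_ord_widen_cond N.+1 xpredT (fun j =>
  f (ptake j (ptake i p)) * g (pdrop j (ptake i p)) * h (pdrop i p))) ?ltn_ord //.
apply: eq_bigr => j /= ji; rewrite /F subnKC // ptake_take //.
by rewrite -pdrop_take subnKC.
Qed.

Lemma series_mul1 : left_id series_one series_mul.
Proof.
move=> f; apply: funext => p; rewrite /series_mul big_ord_recl big1 ?addr0 /=.
  by rewrite /series_one pdrop0 /pword /= take0 eqxx mul1r.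
move=> n _; rewrite /series_one -size_eq0 {1}/pword /=.
by rewrite size_takel ?mul0r // ltn_ord.
Qed.

Lemma series_mulr1 : right_id series_one series_mul.
Proof.
move=> f; apply: funext => p; rewrite /series_mul big_ord_recr big1 /=.
  by rewrite /series_one ptake_over // /pword /= drop_size add0r eqxx mulr1.
move=> n _; rewrite /series_one -size_eq0 /pword /= size_drop subn_eq0.
by rewrite leqNgt ltn_ord mulr0.
Qed.

Lemma series_mulDl : left_distributive series_mul +%R.
Proof.
move=> f g h; apply: funext => p; rewrite [RHS]/GRing.add /= /series_add.
by rewrite -big_split; apply: eq_bigr => n _; apply: mulrDl.
Qed.

Lemma series_mulDr : right_distributive series_mul +%R.
Proof.
move=> f g h; apply: funext => p; rewrite [RHS]/GRing.add /= /series_add.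
by rewrite -big_split; apply: eq_bigr => n _; apply: mulrDr.
Qed.

HB.instance Definition _ := GRing.Zmodule_isPzRing.Build A
  series_mulA series_mul1 series_mulr1 series_mulDl series_mulDr.

(* Algebra automorphisms that are the identity on R = span of the idem i.     *)
(* Such an automorphism preserves the ideals of series starting in length n,  *)
(* so it is continuous and determined by its values on arrows.                *)
Record right_equivalence (phi : A -> A) : Prop := RightEquivalence {
  right_eq_bij : bijective phi;
  right_eq_linear : linear phi;
  right_eq_monoid : monoid_morphism phi;
  right_eq_idem : forall i, phi (idem i) = idem i }.

End PathAlgebra.

Section Cycles.
Variable Q : quiver.

Definition is_cyclic (p : qpath Q) : bool :=
  (pword p != [::]) && (psrc p == ptgt p).

Definition cyc_path := {p : qpath Q | is_cyclic p}.
Implicit Types c : cyc_path.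

Definition cword c : seq (arrow Q) := pword (val c).

Lemma cword_inj : injective cword.
Proof.
move=> c c' ecc; apply: val_inj; apply: qpath_eq => //.
move: ecc (valP (val c)) (valP (val c')) (valP c); rewrite /is_cyclic.
rewrite /cword /ptgt /pword; case: (val (val c)) => i w /= ->.
by case: (val (val c')) => j [|a v] //= /andP[/eqP-> _] /andP[/eqP-> _].
Qed.

Lemma crot_subproof n c :
  let q := (psrc (ptake n (val c)), rot n (cword c)) in chain q.1 q.2.
Proof.
have /= := valP (val c); have /andP[_ /eqP ce] := valP c.
rewrite -[X in chain _ X](cat_take_drop n) /rot !chain_cat => /andP[ct cd].
rewrite cd /= /psrc -chain_src_cat /cword cat_take_drop.
by move: ce; rewrite /psrc => ->.
Qed.

Lemma crot_subproof2 n c :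
  is_cyclic (Sub (psrc (ptake n (val c)), rot n (cword c)) (crot_subproof n c)).
Proof.
have /andP[c0 /eqP ce] := valP c.
rewrite /is_cyclic {1}/pword /= -size_eq0 size_rot size_eq0 c0 /=.
rewrite /psrc /ptgt /pword /= /rot chain_src_cat -chain_src_cat -chain_src_cat.
rewrite catA cat_take_drop chain_src_cat -/(psrc (val c)).
by move: ce; rewrite /psrc => ->.
Qed.

(* a_1 ... a_l  |->  a_(n+1) ... a_l a_1 ... a_n                               *)
Definition crot n c : cyc_path := Sub _ (crot_subproof2 n c).

Definition rotations c : seq cyc_path :=
  undup [seq crot n c | n <- iota 0 (size (cword c))].

Definition rot_eq c c' : bool := c' \in rotations c.

Lemma rot_eqP c c' :
  reflect (exists n, cword c' = rot n (cword c)) (rot_eq c c').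
Proof.
rewrite /rot_eq mem_undup; apply: (iffP mapP) => [[n _ ->]|[n ec]].
  by exists n.
have s0 : (0 < size (cword c))%N by rewrite lt0n size_eq0; case/andP: (valP c).
have [nl|nl] := ltnP n (size (cword c)).
  by exists n; [rewrite mem_iota | apply: cword_inj].
exists 0%N; first by rewrite mem_iota.
by apply: cword_inj; rewrite ec rot_oversize // /cword /= [RHS]rot0.
Qed.

Lemma rot_eq_refl : reflexive rot_eq.
Proof. by move=> c; apply/rot_eqP; exists 0%N; rewrite rot0. Qed.

Lemma rot_eq_sym : symmetric rot_eq.
Proof.
suff H c c' : rot_eq c c' -> rot_eq c' c by move=> c c'; apply/idP/idP; apply: H.
move=> /rot_eqP[n e]; apply/rot_eqP; exists (size (rot n (cword c)) - n)%N.
by rewrite e -/(rotr n _) rotK.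
Qed.

Lemma rot_eq_trans : transitive rot_eq.
Proof.
move=> c2 c1 c3 /rot_eqP[n e] /rot_eqP[l e']; apply/rot_eqP.
by rewrite e' e rot_rot_add; eexists.
Qed.

Canonical rot_equiv := EquivRel rot_eq rot_eq_refl rot_eq_sym rot_eq_trans.

Definition cyc_class := {eq_quot rot_equiv}.
HB.instance Definition _ := Choice.on cyc_class.
HB.instance Definition _ := EqQuotient.on cyc_class.

Definition chord c (b : arrow Q) (i j : 'I_(size (cword c))) : bool :=
  [&& i != j, tgt b == tgt (tnth (in_tuple (cword c)) i)
            & src b == src (tnth (in_tuple (cword c)) j)].

Definition chordless c : bool :=
  ~~ [exists b, exists i, exists j, @chord c b i j].

Lemma chordless_rot n c : (n <= size (cword c))%N ->
  chordless c -> chordless (crot n c).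
Proof.
move=> nc; apply: contraNN => /existsP[b /existsP[i /existsP[j]]] /and3P[ij].
have sr : size (cword (crot n c)) = size (cword c) by rewrite size_rot.
pose f (x : 'I_(size (cword (crot n c)))) : nat :=
  if (x < size (cword c) - n)%N then (n + x)%N else (x - (size (cword c) - n))%N.
have lt (x : 'I_(size (cword (crot n c)))) : (x < size (cword c))%N.
  by rewrite -[X in (_ < X)%N]sr.
have fl x : (f x < size (cword c))%N.
  rewrite /f; case: ifP => [|xl]; first by rewrite ltn_subRL.
  by apply: leq_ltn_trans (leq_subr _ _) (lt x).
have fi x y : f x = f y -> x = y.
  have := lt x; have := lt y => yl xl; rewrite /f => e.
  apply: val_inj => /=; move: e nc xl yl; set N := size _.
  by do 2 case: ifP; lia.
have fn x : tnth (in_tuple (cword (crot n c))) x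
          = tnth (in_tuple (cword c)) (Ordinal (fl x)).
  rewrite !(tnth_nth b) /= /f {1}/cword /pword /= /rot nth_cat size_drop.
  rewrite -/(cword c); have := lt x.
  case xl: (x < size (cword c) - n)%N => xs; first by rewrite nth_drop.
  by rewrite nth_take //; lia.
rewrite !fn => tb sb; apply/existsP; exists b.
apply/existsP; exists (Ordinal (fl i)); apply/existsP; exists (Ordinal (fl j)).
rewrite /chord tb sb !andbT; apply: contraNneq ij => -[e].
exact/eqP/fi.
Qed.

Definition class_chordless (C : cyc_class) : bool := chordless (repr C).

Lemma class_chordlessE c : class_chordless (\pi c) = chordless c.
Proof.
suff H c1 c2 : rot_eq c1 c2 -> chordless c1 -> chordless c2.
  rewrite /class_chordless; apply/idP/idP; apply: H.
    by rewrite -[rot_eq _ _]/(rot_equiv _ _) -eqmodE reprK.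
  by rewrite -[rot_eq _ _]/(rot_equiv _ _) -eqmodE reprK.
rewrite /rot_eq mem_undup => /mapP[n]; rewrite mem_iota add0n => /andP[_ nl] ->.
by apply: chordless_rot; apply: ltnW.
Qed.

End Cycles.

Section Potentials.
Variables (k : fieldType) (Q : quiver).
Local Notation A := (cpath_alg k Q).

Definition potential : Type := cyc_class Q -> k.
Implicit Types W : potential.

(* The class of f modulo cyclic shifts (its non-cyclic terms are dropped).    *)
Definition cyc_proj (f : A) : potential :=
  fun C => \sum_(c <- rotations (repr C)) f (val c).

(* A series representing W, supported on one path in each rotation class.     *)
Definition cyc_lift W : A := fun p =>
  if insub p is Some c then
    if repr (\pi_(cyc_class Q) c) == c then W (\pi c) else 0
  else 0.

Lemma cyc_liftK : cancel cyc_lift cyc_proj.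
Proof.
move=> W; apply: funext => C; rewrite /cyc_proj.
have Cin : repr C \in rotations (repr C) by apply: rot_eq_refl.
rewrite (bigD1_seq _ Cin) ?undup_uniq //= big1_seq ?addr0.
  by rewrite /cyc_lift valK reprK eqxx.
move=> c /andP[cC cin]; rewrite /cyc_lift valK; case: eqP => // e.
suff E : C = \pi c by rewrite -e -E eqxx in cC.
rewrite -[C]reprK; apply/eqP; rewrite eqmodE; exact: cin.
Qed.

(* For a right-equivalence phi, which is continuous and multiplicative, the   *)
(* result does not depend on the representative chosen by cyc_lift.           *)
Definition pot_act (phi : A -> A) W : potential :=
  cyc_proj (phi (cyc_lift W)).

Definition primitive W : Prop := forall C, (W C != 0) = class_chordless C.

Definition prim_part W : potential :=
  fun C => if class_chordless C then W C else 0.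

Definition generic W : Prop := primitive (prim_part W).

Definition preserves_primitive (phi : A -> A) : Prop :=
  forall W, primitive (pot_act phi W) <-> primitive W.

Definition same_orbit W W' : Prop := exists phi : A -> A,
  [/\ right_equivalence phi, preserves_primitive phi & pot_act phi W = W'].

(* Exponents of a Laurent monomial in the coefficients of a potential.        *)
Definition monomial := seq (cyc_class Q * int).
Definition monomial_val (u : monomial) W : k := \prod_(e <- u) W e.1 ^ e.2.

(* Inverse direction: a potential on the chordless cycles whose coefficients  *)
(* are the Laurent monomials in y_0, ..., y_(r-1) with exponents S C.         *)
Definition monomial_pot r (S : cyc_class Q -> 'I_r -> int) (y : 'I_r -> k) :
    potential :=
  fun C => if class_chordless C then \prod_(j < r) y j ^ S C j else 0.

(* The primitive potentials form the torus of their coefficients on chordless *)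
(* cycles. Its quotient by the right-equivalences preserving it is isomorphic *)
(* to (k^x)^r, as an algebraic torus: a map F with monomial components in the *)
(* coefficients at chordless cycles separates exactly the orbits, hence       *)
(* embeds the orbit space in (k^x)^r, and the map y |-> orbit of S(y), again  *)
(* monomial, is its inverse.                                                  *)
Definition primitive_quotient_isom_torus (r : nat) : Prop :=
  exists (F : 'I_r -> monomial) (S : cyc_class Q -> 'I_r -> int),
  [/\ forall j, all (fun e => class_chordless e.1) (F j),
      forall W W', primitive W -> primitive W' ->
        same_orbit W W' <-> (forall j, monomial_val (F j) W = monomial_val (F j) W')
    & forall y : 'I_r -> k, (forall j, y j != 0) ->
        forall j, monomial_val (F j) (monomial_pot S y) = y j].

End Potentials.

(* Oriented triangles with corners 0, 1, 2 in counterclockwise order; the     *)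
(* side (t, i) is opposite to the corner i and runs from the corner i+1 to    *)
(* the corner i+2 = i-1. Each side is glued to exactly one other side,        *)
(* reversing the direction, so that the orientations of the triangles agree.  *)
Record triangle_gluing := TriangleGluing {
  triangle : finType;
  glue : triangle * 'I_3 -> triangle * 'I_3;
  glueK : involutive glue;
  glue_neq : forall s, glue s != s }.

Section Surface.
Variable T : triangle_gluing.

(* The end of the side i+1 is the corner i; crossing this side leads to the   *)
(* next triangle around the same marked point. The marked points are the      *)
(* cycles of this permutation of the corners, the arcs are those of glue.     *)
Definition corner_rot (c : triangle T * 'I_3) : triangle T * 'I_3 :=
  let s := glue (c.1, ordS c.2) in (s.1, ordS s.2).

Lemma corner_rot_inj : injective corner_rot.
Proof.
have inv : forall s s' : triangle T * 'I_3,
    (s.1, ordS s.2) = (s'.1, ordS s'.2) -> s = s'.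
  by move=> [t i] [t' i'] [/= -> e]; congr pair; apply/ordS_inj/val_inj.
move=> c c' /inv /(can_inj (@glueK T)) e; exact: inv.
Qed.

Definition adjacent (t t' : triangle T) : bool :=
  [exists i, exists j, glue (t, i) == (t', j)].

(* Connected, with d marked points and Euler characteristic 2 - 2g.           *)
Record triangulated_surface (g d : nat) : Prop := TriangulatedSurface {
  ts_connected : forall t t', connect adjacent t t';
  ts_points : fcard corner_rot predT = d;
  ts_euler : (d + #|triangle T| + 2 * g = fcard (@glue T) predT + 2)%N }.

Definition no_loop_arcs : Prop :=
  forall t i, ~~ fconnect corner_rot (t, ordS i) (t, ord_pred i).

(* The valence of a marked point is the number of corners at it.              *)
Definition valence_ge3 : Prop := forall c, (3 <= order corner_rot c)%N.

End Surface.

Section TriangulationQuiver.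
Variables (T : triangle_gluing) (m : nat).

Definition is_node (x : {ffun 'I_3 -> 'I_m.+2}) : bool :=
  (\sum_i (x i : nat) == m.+1)%N && [forall i, x i != m.+1 :> nat].
Definition node := {x : {ffun 'I_3 -> 'I_m.+2} | is_node x}.

Definition black := {a : {ffun 'I_3 -> 'I_m} | ((\sum_i (a i : nat)).+1 == m)%N}.

(* For k = 0, 1, 2: (a,b+1,c+1), (a+1,b,c+1), (a+1,b+1,c), which is the       *)
(* counterclockwise order since the corner k of Delta has k-th coordinate m+1. *)
Definition black_corner_fun (a : black) (k : 'I_3) : {ffun 'I_3 -> 'I_m.+2} :=
  [ffun i => inord (val a i + (i != k))].

Lemma black_corner_subproof a k : is_node (black_corner_fun a k).
Proof.
have E i : (black_corner_fun a k i : nat) = (val a i + (i != k))%N.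
  by rewrite ffunE inordK //; have := ltn_ord (val a i); case: (i != k) => /=; lia.
apply/andP; split; last first.
  apply/forallP => i; rewrite E neq_ltn; apply/orP; left.
  by have := ltn_ord (val a i); case: (i != k) => /=; lia.
rewrite (eq_bigr _ (fun i _ => E i)) big_split /=.
have -> : (\sum_i (i != k) = 2)%N.
  by case: k {E} => [[|[|[|]]] ?] //; rewrite !big_ord_recl big_ord0.
by rewrite addn2 eqSS; exact: (valP a).
Qed.
Definition black_corner a k : node := Sub (_ : {ffun _}) (black_corner_subproof a k).

(* The point p on the side i of a triangle (p_i = 0) is identified with the   *)
(* point q on the side j glued to it; corner i+1 meets corner j+2.            *)
Definition glued (p q : triangle T * node) : bool :=
  [exists i, exists j,
    [&& glue (p.1, i) == (q.1, j), val p.2 i == 0%N :> nat, val q.2 j == 0%N :> nat,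
        val q.2 (ordS j) == val p.2 (ord_pred i)
      & val q.2 (ord_pred j) == val p.2 (ordS i)]].

Lemma glued_sym : symmetric glued.
Proof.
suff H p q : glued p q -> glued q p by move=> p q; apply/idP/idP; apply: H.
case/existsP=> i /existsP[j /and5P[/eqP e pi qj /eqP e1 /eqP e2]].
apply/existsP; exists j; apply/existsP; exists i.
by rewrite -e glueK e1 e2 pi qj !eqxx.
Qed.

Lemma glued_connect_sym : symmetric (connect glued).
Proof. exact: sym_connect_sym glued_sym. Qed.

Canonical node_equiv :=
  EquivRel (connect glued) (connect0 glued) glued_connect_sym (@connect_trans _ glued).

Definition surface_node := {eq_quot node_equiv}.
HB.instance Definition _ := Choice.on surface_node.
HB.instance Definition _ := EqQuotient.on surface_node.
HB.instance Definition _ : isCountable surface_node :=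
  CanIsCountable (@reprK _ surface_node).
HB.instance Definition _ : isFinite surface_node :=
  CanIsFinite (@reprK _ surface_node).

Definition surface_quiver : quiver := {|
  vert := surface_node;
  arrow := (triangle T * black * 'I_3)%type;
  src := fun u => \pi_surface_node (u.1.1, black_corner u.1.2 u.2);
  tgt := fun u => \pi_surface_node (u.1.1, black_corner u.1.2 (ordS u.2)) |}.

End TriangulationQuiver.

(* Main.v *)
Require Import Defs.
From mathcomp Require Import all_boot all_order all_algebra.
From mathcomp Require Import boolp zify.

(** The second claim holds because a chordless cycle can only come from chordless
    cycles.  If an arrow a is replaced by a path of length at least two inside a
    cycle c, then a joins two vertices of c and is a chord of c.  So, on a quiver
    without loops and parallel arrows, a right-equivalence phi multiplies the
    coefficient of a chordless cycle by the product of the diagonal coefficients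
    of phi over its arrows (pot_act_chordless); the other coefficients of the
    potential never enter.

    For the first claim, the same formula shows that two primitive potentials are in
    one orbit exactly when their coefficients differ by rescaling the arrows
    (same_orbit_weight).  It remains to compute the cokernel of the incidence
    matrix between arrows and chordless cycles.

    An arrow runs parallel to a side of its triangle, at some distance from the
    opposite corner, around which it turns.  From the end of an arrow a path can
    continue in three ways: around the small black triangle, around the white
    face on the other side of the arrow (a white triangle, a quadrilateral
    across an arc, or the innermost polygon around a puncture), or straight,
    staying at the same distance from the puncture.  Each way is a permutation
    of the arrows: turnB, turnW, turnS.  A turn to a black or white face inside
    a cycle makes the remaining side of the face a chord, unless the cycle is
    the boundary of the face; hence the chordless cycles are exactly the orbits
    of the three permutations (chordless_class).  The straight orbits are the
    circles of radius 1, ..., m around the d punctures, and those of radius 1 are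
    also white faces.

    The faces cut the surface into cells, and every arrow lies between one black
    and one white face.  Since the surface is connected, arrow scalars with
    prescribed products over all faces exist as soon as the product over the
    black faces equals the product over the white ones (orbit_prod_solve,
    bw_connected): this is the computation of the second cohomology of the
    surface.  A circle of radius at least 2 bounds a disc tiled by faces, and the
    product over its arrows is the product over the white faces of the disc
    divided by that over the black ones (disc_prod).  So there is one invariant
    for the surface, the quotient of all black by all white coefficients, and one
    for each of the (m-1)d larger circles, the coefficient of the circle
    multiplied by the black and divided by the white coefficients of its disc.
    These monomials separate orbits (orbit_monomial_separates), and a section
    is obtained by putting the parameters on one black face and on the circles
    (section_potK). *)

Set Implicit Arguments.
Unset Strict Implicit.
Unset Printing Implicit Defensive.

Import GRing.Theory.
Local Open Scope ring_scope.
Local Open Scope quotient_scope.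

(** * Chordless cycles letter by letter *)
Section ChordlessWords.
Variable Q : quiver.
Implicit Types (b u v : arrow Q) (w : seq (arrow Q)) (c : cyc_path Q).

(** Chords are defined by positions, but a repeated letter is a chord of itself;
    once letters are distinct, positions can be replaced by letters. *)
Lemma chordlessP c :
  reflect (uniq (cword c) /\ forall b u v, u \in cword c -> v \in cword c ->
             tgt b = tgt u -> src b = src v -> u = v)
          (chordless c).
Proof.
have nthE x0 (i : 'I_(size (cword c))) :
    tnth (in_tuple (cword c)) i = nth x0 (cword c) i by rewrite (tnth_nth x0).
apply: (iffP idP) => [ch|[Uc H]].
  have noc b (i j : 'I_(size (cword c))) : i != j ->
      tgt b = tgt (tnth (in_tuple (cword c)) i) ->
      src b = src (tnth (in_tuple (cword c)) j) -> False.
    move=> ij tb sb; case/negP: ch; apply/existsP; exists b.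
    by apply/existsP; exists i; apply/existsP; exists j; rewrite /chord ij tb sb !eqxx.
  split=> [|b u v uc vc tb sb].
    case E : (cword c) => [//|x0 w]; rewrite -E.
    apply/(uniqP x0) => i j; rewrite !inE => il jl e.
    apply/eqP/negPn/negP => ij.
    by apply: (noc (nth x0 (cword c) i) (Ordinal il) (Ordinal jl));
      rewrite // (nthE x0) //= e.
  move: uc vc; rewrite -!index_mem => ul vl.
  have [/(congr1 val) /= e|ij] := eqVneq (Ordinal ul) (Ordinal vl).
    by rewrite -(nth_index u (s := cword c) (x := u)) ?e ?nth_index // -index_mem.
  by case: (noc b _ _ ij); rewrite (nthE u) /= nth_index // -index_mem.
apply/existsP => -[b /existsP[i /existsP[j /and3P[ij /eqP tb /eqP sb]]]].
rewrite !(nthE b) in tb sb.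
have := H b _ _ (mem_nth b (ltn_ord i)) (mem_nth b (ltn_ord j)) tb sb.
move=> /eqP; rewrite nth_uniq ?ltn_ord //.
by move/eqP/val_inj => e; rewrite e eqxx in ij.
Qed.

(** No arrow is parallel to a subpath of length at least two.  Unlike
    chordlessness this passes to subpaths, so it supports induction on paths. *)
Definition taut w : bool :=
  pairwise (fun u v => [forall b, (tgt b == tgt u) ==> (src b != src v)]) w.

Lemma chordless_taut c : chordless c -> taut (cword c).
Proof.
move=> /chordlessP[Uc H]; move: (Uc); rewrite uniq_pairwise /taut.
apply: (sub_in_pairwise (P := mem (cword c))); last by apply/allP.
move=> u v /= uc vc uv; apply/forallP => b; apply/implyP => /eqP tb.
by apply: contraNneq uv => sb; rewrite (H b u v).
Qed.

End ChordlessWords.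

(** * Series split along their first arrow *)
Section Letters.
Variables (k : fieldType) (Q : quiver).
Local Notation A := (cpath_alg k Q).
Implicit Types (a b : arrow Q) (p q : qpath Q) (f g : A) (i : vert Q).

Lemma arrow_path_subproof a : let q := (tgt a, [:: a]) in chain q.1 q.2.
Proof. by rewrite /= eqxx. Qed.
Definition arrow_path a : qpath Q := Sub (tgt a, [:: a]) (arrow_path_subproof a).

Definition arrow_series a : A := fun p => (p == arrow_path a)%:R.

(** A series g such that f and arrow_series a * g agree on the words beginning
    with a. *)
Definition left_quotient a f : A :=
  fun q => if insub (tgt a, a :: pword q) is Some p then f p else 0.

Lemma series_addE f g p : (f + g) p = f p + g p.
Proof. by []. Qed.

Lemma series_scaleE (x : k) f p : (x *: f) p = x * f p.
Proof. by []. Qed.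

Lemma series_mulE f g p :
  (f * g) p = \sum_(n < (size (pword p)).+1) f (ptake n p) * g (pdrop n p).
Proof. by []. Qed.

Lemma series_sumE (I : finType) (F : I -> A) p : (\sum_i F i) p = \sum_i F i p.
Proof. by elim/big_rec2: _ => //= i x f _ <-. Qed.

Lemma path_nil p : pword p = [::] -> p = triv_path (ptgt p).
Proof. by move=> e; apply: qpath_eq; rewrite // e. Qed.

Lemma path_ptgt p a w : pword p = a :: w -> ptgt p = tgt a.
Proof.
by move: (valP p); rewrite /ptgt /pword => + e; rewrite e /= => /andP[/eqP].
Qed.

Lemma path_ptake1 p a w : pword p = a :: w -> ptake 1 p = arrow_path a.
Proof.
by move=> e; apply: qpath_eq; [exact: path_ptgt e|rewrite /pword /= -/(pword p) e /= take0].
Qed.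

Lemma idem_mulE i f p : (idem k i * f) p = if ptgt p == i then f p else 0.
Proof.
rewrite series_mulE big_ord_recl big1 ?addr0; last first.
  move=> n _; rewrite /idem; case: eqP => [/(congr1 (fun q => size (pword q)))|_].
    by rewrite [pword (ptake _ _)]/= size_takel.
  by rewrite mul0r.
rewrite pdrop0 /idem; case: (eqVneq (ptgt p) i) => [<-|ne].
  by rewrite [ptake _ _ == _](_ : _ = true) ?mul1r //;
     apply/eqP/qpath_eq; rewrite // /pword /= take0.
case: eqP => [/(congr1 (@ptgt Q)) /= e|_]; last by rewrite mul0r.
by move: ne; rewrite -[ptgt p]/(ptgt (ptake 0 p)) e eqxx.
Qed.

Lemma mul_idemE i f p : (f * idem k i) p = if psrc p == i then f p else 0.
Proof.
rewrite series_mulE big_ord_recr big1 ?add0r /=; last first.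
  move=> n _; rewrite /idem; case: eqP => [/(congr1 (fun q => size (pword q)))|_].
    rewrite [pword (pdrop _ _)]/= size_drop /= => e.
    by have := ltn_ord n; rewrite -subn_gt0 e.
  by rewrite mulr0.
rewrite ptake_over // /idem.
have -> : pdrop (size (pword p)) p = triv_path (psrc p).
  by apply: qpath_eq; rewrite /ptgt /= ?ptake_over // /pword /= drop_size.
rewrite -(inj_eq val_inj) /= xpair_eqE eqxx andbT.
by rewrite add0r; case: (psrc p == i); rewrite ?mulr1 ?mulr0.
Qed.

Lemma arrow_mulE a f p :
  (arrow_series a * f) p = if ohead (pword p) == Some a then f (pdrop 1 p) else 0.
Proof.
rewrite series_mulE.
case E : (pword p) => [|b w] /=.
  rewrite big_ord_recl big_ord0 /arrow_series -(inj_eq val_inj) /= xpair_eqE.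
  by rewrite -/(pword p) E andbF mul0r addr0.
rewrite big_ord_recl big_ord_recl big1 ?addr0 /=; last first.
  move=> n _; rewrite /arrow_series.
  case: eqP => [/(congr1 (fun q => size (pword q)))|_]; last by rewrite mul0r.
  rewrite [pword (ptake _ _)]/= size_takel; first by rewrite /= /bump.
  by rewrite E; apply: ltn_ord (lift ord0 (lift ord0 n)).
rewrite {1}/arrow_series -(inj_eq val_inj) /= xpair_eqE -/(pword p) E /= andbF mul0r add0r.
rewrite /bump /= (path_ptake1 E) /arrow_series -(inj_eq val_inj) /=.
rewrite xpair_eqE eqseq_cons andbT.
have -> : (Some b == Some a) = (b == a) by [].
by have [->|_] := eqVneq b a; rewrite ?eqxx ?mul1r ?andbF ?mul0r.
Qed.

Lemma arrow_series_idem a :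
  arrow_series a = idem k (tgt a) * (arrow_series a * idem k (src a)).
Proof.
apply: funext => p; rewrite idem_mulE mul_idemE /arrow_series.
case: (eqVneq p (arrow_path a)) => [->|_]; last by rewrite !if_same.
by rewrite /psrc /chain_src /= !eqxx.
Qed.

(** Every nontrivial path has a unique first letter.  The sum over arrows is
    finite, so additivity and multiplicativity of a right-equivalence apply to
    it directly, whatever infinite series f is. *)
Lemma series_decomp f :
  f = \sum_i f (triv_path i) *: idem k i
    + \sum_a arrow_series a * left_quotient a f.
Proof.
apply: funext => p; rewrite series_addE !series_sumE.
case E : (pword p) => [|a w].
  rewrite [X in _ + X]big1 ?addr0; last by move=> a _; rewrite arrow_mulE E.
  rewrite {1 2}(path_nil E) (bigD1 (ptgt p)) //= big1 ?addr0.
    by rewrite series_scaleE /idem eqxx mulr1.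
  move=> i ne; rewrite series_scaleE /idem.
  by rewrite -(inj_eq val_inj) /= xpair_eqE eq_sym (negPf ne) mulr0.
rewrite big1 ?add0r => [|i _]; last first.
  rewrite series_scaleE /idem; case: eqP => [e|_]; last by rewrite mulr0.
  by move: E; rewrite e.
rewrite (bigD1 a) //= big1 ?addr0 => [|b ne]; last first.
  by rewrite arrow_mulE E /=; case: eqP => // -[e]; rewrite e eqxx in ne.
rewrite arrow_mulE E eqxx /left_quotient.
have -> : (tgt a, a :: pword (pdrop 1 p)) = val p.
  rewrite [RHS]surjective_pairing -/(ptgt p) -/(pword p) (path_ptgt E) E.
  by rewrite /pword /= -/(pword p) E /= drop0.
by rewrite valK.
Qed.

End Letters.

(** * Right-equivalences on taut paths *)
Section RightEquivalences.
Variables (k : fieldType) (Q : quiver).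
Local Notation A := (cpath_alg k Q).
Hypothesis noloop : forall a : arrow Q, src a != tgt a.
Hypothesis noparallel :
  forall a b : arrow Q, src a = src b -> tgt a = tgt b -> a = b.
Variable phi : A -> A.
Hypothesis phiP : right_equivalence phi.
Implicit Types (a b : arrow Q) (p q : qpath Q) (f g : A) (W : potential k Q).

Definition diag_coef a : k := phi (arrow_series k a) (arrow_path a).

Lemma right_eqM f g : phi (f * g) = phi f * phi g.
Proof. exact: (right_eq_monoid phiP).2. Qed.

Lemma right_eqD f g : phi (f + g) = phi f + phi g.
Proof. by have := right_eq_linear phiP 1 f g; rewrite !scale1r. Qed.

Lemma right_eq0 : phi 0 = 0.
Proof. by apply: (addIr (phi 0)); rewrite -right_eqD !add0r. Qed.

Lemma right_eqZ x f : phi (x *: f) = x *: phi f.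
Proof. by have := right_eq_linear phiP x f 0; rewrite right_eq0 !addr0. Qed.

Lemma right_eq_sum (I : finType) (F : I -> A) : phi (\sum_i F i) = \sum_i phi (F i).
Proof. by apply: (big_morph phi right_eqD right_eq0). Qed.

(** An arrow equals e_t * a * e_s, and phi fixes the idempotents, so the image of
    an arrow only involves paths parallel to it. *)
Lemma right_eq_arrow a p : phi (arrow_series k a) p != 0 ->
  ptgt p = tgt a /\ psrc p = src a.
Proof.
rewrite arrow_series_idem !right_eqM !(right_eq_idem phiP) idem_mulE mul_idemE.
have [->|_] := eqVneq (ptgt p) (tgt a); last by rewrite eqxx.
by have [->|_] := eqVneq (psrc p) (src a); last by rewrite eqxx.
Qed.

(** A path parallel to a is trivial (then a is a loop), has length at least two
    (then a is a shortcut), or is an arrow parallel to a. *)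
Lemma right_eq_arrow_taut a p : taut (pword p) -> p != arrow_path a ->
  phi (arrow_series k a) p = 0.
Proof.
move=> tp pa; apply/eqP/negPn/negP => /right_eq_arrow[tp' sp'].
have := noloop a; rewrite -tp' -sp' /psrc /chain_src.
case E : (pword p) => [|u w] /=; first by rewrite eqxx.
have tu := path_ptgt E.
case: w E => [|v w] E; last first.
  move: tp; rewrite E /taut pairwise_cons => /andP[/allP H _] _.
  pose l := last v w.
  have lin : l \in v :: w by apply: mem_last.
  have /forallP/(_ a) := H _ lin; rewrite -tu tp' eqxx /=.
  by rewrite -sp' /psrc /chain_src E /= last_map eqxx.
move=> _; case/eqP: pa.
have ua : u = a.
  by apply: noparallel; [rewrite -sp' /psrc /chain_src E | rewrite -tu].
by apply: qpath_eq; [rewrite tp' | rewrite E ua].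
Qed.

(** In the product phi (a) * phi (g), where f starts with a * g, the first factor
    can only contribute the first letter of p, with its diagonal coefficient;
    the second factor is evaluated on the rest of p, which is again taut. *)
Lemma right_eq_taut p f : taut (pword p) ->
  phi f p = (\prod_(a <- pword p) diag_coef a) * f p.
Proof.
have [n] := ubnP (size (pword p)); elim: n => // n IH in p f *.
move=> pn tp; rewrite {1}(series_decomp f) right_eqD !right_eq_sum.
rewrite series_addE !series_sumE.
rewrite (eq_bigr (fun i => f (triv_path i) * idem k i p)) => [|i _]; last first.
  by rewrite right_eqZ (right_eq_idem phiP) series_scaleE.
rewrite [X in _ + X](eq_bigr (fun a =>
  (phi (arrow_series k a) * phi (left_quotient a f)) p)) => [|a _]; last first.
  by rewrite right_eqM.
case E : (pword p) => [|a w].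
  rewrite [X in _ + X]big1 => [|a _]; last first.
    rewrite series_mulE E /= big_ord1.
    rewrite right_eq_arrow_taut ?mul0r //=.
      by rewrite /pword /= take0.
    by rewrite -(inj_eq val_inj) /= xpair_eqE -/(pword p) E andbF.
  rewrite addr0 big_nil mul1r (bigD1 (ptgt p)) //= big1 => [|i ne]; last first.
    by rewrite /idem {1}(path_nil E) -(inj_eq val_inj) /= xpair_eqE eq_sym (negPf ne) mulr0.
  by rewrite addr0 /idem -(path_nil E) eqxx mulr1.
rewrite big1 ?add0r => [|i _]; last first.
  by rewrite /idem -(inj_eq val_inj) /= [val p]surjective_pairing -/(pword p) E
             xpair_eqE andbF mulr0.
have E1 := path_ptake1 E.
have tdrop : taut (pword (pdrop 1 p)).
  move: tp; rewrite /taut E pairwise_cons => /andP[_].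
  by rewrite /pword /= -/(pword p) E /= drop0.
have sdrop : pword (pdrop 1 p) = w by rewrite /pword /= -/(pword p) E /= drop0.
have mulE b : (phi (arrow_series k b) * phi (left_quotient b f)) p =
   if b == a then diag_coef a * phi (left_quotient a f) (pdrop 1 p) else 0.
  have ttake l : taut (pword (ptake l p)).
    by apply: subseq_pairwise tp; rewrite /pword /=; apply: take_subseq.
  rewrite series_mulE E big_ord_recl big_ord_recl big1 ?addr0 => [|l _].
    have -> : phi (arrow_series k b) (ptake (ord0 : 'I_(size (a :: w)).+1) p) = 0.
      by rewrite right_eq_arrow_taut // -(inj_eq val_inj) /= xpair_eqE take0 andbF.
    rewrite mul0r add0r /bump /= E1; case: eqP => [->//|ne].
    have ta : taut (pword (arrow_path a)) by [].
    rewrite (right_eq_arrow_taut ta) ?mul0r //.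
    by apply/eqP => /(congr1 (@pword Q)) [e]; case: ne.
  rewrite (right_eq_arrow_taut (ttake _)) ?mul0r //.
  rewrite -(inj_eq val_inj) /= xpair_eqE -/(pword p) E /= /bump /=.
  by case: w E l sdrop => [|v w'] // E [l] /=; rewrite ?eqseq_cons ?andbF.
rewrite (eq_bigr _ (fun b _ => mulE b)) -big_mkcond big_pred1_eq.
rewrite IH //; last by move: pn; rewrite sdrop E.
rewrite sdrop big_cons mulrA; congr (_ * _).
rewrite /left_quotient sdrop.
have -> : (tgt a, a :: w) = val p.
  by rewrite [RHS]surjective_pairing -/(ptgt p) -/(pword p) (path_ptgt E) E.
by rewrite valK.
Qed.

End RightEquivalences.

(** * The action on chordless coefficients *)
Section ChordlessCoefficients.
Variables (k : fieldType) (Q : quiver).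
Local Notation A := (cpath_alg k Q).
Implicit Types (a b : arrow Q) (W : potential k Q) (C : cyc_class Q).

Definition class_weight (lam : arrow Q -> k) C : k :=
  \prod_(a <- cword (repr C)) lam a.

Lemma rotations_weight (lam : arrow Q -> k) c c' : c' \in rotations c ->
  \prod_(a <- cword c') lam a = \prod_(a <- cword c) lam a.
Proof.
case/(rot_eqP c c') => n ->; apply: perm_big.
by rewrite perm_rot.
Qed.

Lemma cyc_proj_weight (lam : arrow Q -> k) W C (f : A) :
  (forall c, c \in rotations (repr C) ->
     f (val c) = (\prod_(a <- cword c) lam a) * cyc_lift W (val c)) ->
  cyc_proj f C = class_weight lam C * W C.
Proof.
move=> H; rewrite -[in RHS](cyc_liftK W) /cyc_proj mulr_sumr.
by apply: eq_big_seq => c cC; rewrite H // (rotations_weight _ cC).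
Qed.

Lemma rotations_chordless C c :
  class_chordless C -> c \in rotations (repr C) -> chordless c.
Proof.
rewrite -{1}[C]reprK class_chordlessE mem_undup => ch /mapP[n].
rewrite mem_iota add0n => /andP[_ /ltnW nl] ->.
exact: chordless_rot.
Qed.

(** The primitive part of the image of W thus depends only on the primitive part
    of W: the right-hand side sees W at the chordless class C alone. *)
Lemma pot_act_chordless phi W C :
  (forall a : arrow Q, src a != tgt a) ->
  (forall a b : arrow Q, src a = src b -> tgt a = tgt b -> a = b) ->
  right_equivalence phi -> class_chordless C ->
  pot_act phi W C = class_weight (diag_coef phi) C * W C.
Proof.
move=> nl np phiP ch; apply: cyc_proj_weight => c cC.
by apply: right_eq_taut => //; apply/chordless_taut/(rotations_chordless ch).
Qed.

Definition rescale (lam : arrow Q -> k) (f : A) : A :=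
  fun p => (\prod_(a <- pword p) lam a) * f p.

Lemma rescale_right_eq (lam : arrow Q -> k) :
  (forall a, lam a != 0) -> right_equivalence (rescale lam).
Proof.
move=> lam0.
have canc (l l' : arrow Q -> k) : (forall a, l a * l' a = 1) ->
    cancel (rescale l) (rescale l').
  move=> e f; apply: funext => p; rewrite /rescale mulrA -big_split /=.
  by rewrite big1 ?mul1r // => a _; rewrite mulrC.
split.
- exists (rescale (fun a => (lam a)^-1)); apply: canc => a.
    by rewrite mulfV.
  by rewrite mulVf.
- move=> x f g; apply: funext => p; rewrite series_addE series_scaleE.
  by rewrite /rescale series_addE series_scaleE mulrDr mulrCA.
- split=> [|f g]; apply: funext => p.
    rewrite /GRing.one /= /rescale /series_one.
    by case: eqP => [->|]; rewrite ?mulr0 // big_nil mul1r.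
  rewrite series_mulE /rescale series_mulE mulr_sumr; apply: eq_bigr => n _.
  rewrite [_ * f _ * _]mulrACA -big_cat /=; congr (_ * _).
  by apply: congr_big => //; rewrite /pword /= cat_take_drop.
- move=> i; apply: funext => p; rewrite /rescale /idem.
  by case: eqP => [->|]; rewrite ?mulr0 // big_nil mul1r.
Qed.

Lemma pot_act_rescale (lam : arrow Q -> k) W C :
  pot_act (rescale lam) W C = class_weight lam C * W C.
Proof. exact: cyc_proj_weight. Qed.

(** Rescaling the arrows is a right-equivalence preserving primitivity, and
    conversely the diagonal coefficients of a right-equivalence do the
    rescaling.  They are nonzero because each arrow lies on a chordless cycle,
    whose coefficient in the image is nonzero. *)
Lemma same_orbit_weight W W' :
  (forall a : arrow Q, src a != tgt a) ->
  (forall a b : arrow Q, src a = src b -> tgt a = tgt b -> a = b) ->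
  (forall a : arrow Q, exists2 C, class_chordless C & a \in cword (repr C)) ->
  primitive W -> primitive W' ->
  same_orbit W W' <->
  exists2 lam : arrow Q -> k, forall a, lam a != 0
    & forall C, class_chordless C -> W' C = class_weight lam C * W C.
Proof.
move=> nl np cover prW prW'; split=> [[phi [phiP _ e]]|[lam lam0 e]].
  exists (diag_coef phi) => [a|C ch]; last by rewrite -e pot_act_chordless.
  have [C ch aC] := cover a.
  have := prW' C; rewrite ch -e pot_act_chordless // mulf_eq0 negb_or.
  case/andP => /negP w0 _; apply/eqP => a0; apply: w0.
  by rewrite /class_weight (big_rem a) //= a0 mul0r.
have w0 C : class_weight lam C != 0.
  by rewrite /class_weight prodf_seq_neq0; apply/allP => a _ /=.
exists (rescale lam); split; first exact: rescale_right_eq.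
  move=> V; split=> prV C; move: (prV C); rewrite pot_act_rescale mulf_eq0 negb_or w0 //.
apply: funext => C; rewrite pot_act_rescale.
have [ch|nch] := boolP (class_chordless C); first by rewrite e.
have /negbFE/eqP-> : (W C != 0) = false by rewrite prW (negPf nch).
have /negbFE/eqP-> : (W' C != 0) = false by rewrite prW' (negPf nch).
exact: mulr0.
Qed.

End ChordlessCoefficients.

(** * Products over the orbits of permutations *)
Section OrbitProducts.
Variables (k : fieldType) (E : finType).
Implicit Types (f g : E -> E) (lam X Y : E -> k) (u v w : E).

Definition orbit_prod f lam u : k := \prod_(v <- orbit f u) lam v.

Lemma orbit_prodE f lam u : orbit_prod f lam u = \prod_(v | fconnect f u v) lam v.
Proof.
rewrite /orbit_prod big_uniq ?orbit_uniq //=.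
by apply: eq_bigl => v; rewrite -fconnect_orbit.
Qed.

Lemma orbit_prod_neq0 f lam u : (forall v, lam v != 0) -> orbit_prod f lam u != 0.
Proof. by move=> l0; rewrite orbit_prodE; apply/prodf_neq0 => v _. Qed.

Lemma orbit_prodM f lam lam' u :
  orbit_prod f (fun v => lam v * lam' v) u = orbit_prod f lam u * orbit_prod f lam' u.
Proof. exact: big_split. Qed.

Lemma orbit_prod_froots f lam (a : pred E) : injective f -> fclosed f a ->
  \prod_(u | froots f u && a u) orbit_prod f lam u = \prod_(v | a v) lam v.
Proof.
move=> fI acl; have sf := fconnect_sym fI.
have aE v : a (froot f v) = a v := esym (closed_connect acl (connect_root _ v)).
rewrite [RHS](partition_big (froot f) (fun u => froots f u && a u)) /=; last first.
  by move=> v av; rewrite aE av andbT; exact: (roots_root sf).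
apply: eq_bigr => u /andP[ru au]; rewrite orbit_prodE; apply: eq_bigl => v.
rewrite -(root_connect sf) (eqP ru) eq_sym.
by case: eqP => [e|]; rewrite ?andbF // andbT -aE e.
Qed.

Lemma orbit_prod_point f x u w :
  orbit_prod f (fun v => if v == u then x else 1) w =
  if fconnect f w u then x else 1.
Proof.
rewrite orbit_prodE -big_mkcondr; case: ifP => wu.
  by rewrite (big_pred1 u) // => v /=; case: eqP => [->|]; rewrite ?andbF // wu.
by rewrite big_pred0 // => v; case: eqP => [->|]; rewrite ?andbF // wu.
Qed.

Lemma orbit_prod1 f u : orbit_prod f (fun _ => 1) u = 1.
Proof. exact: big1_eq. Qed.

Lemma froot_invariant f (T : eqType) (X : E -> T) u :
  (forall v, X (f v) = X v) -> X (froot f u) = X u.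
Proof.
move=> Xf; symmetry; apply: (fconnect_invariant (f := f)); last exact: connect_root.
by move=> v /=; rewrite Xf eqxx.
Qed.

Section TwoPermutations.
Variables f g : E -> E.
Hypotheses (fI : injective f) (gI : injective g).
Hypothesis fg_conn : forall u v, connect [rel x y | (f x == y) || (g x == y)] u v.

(** Scalars x and x^-1 placed at two points of one g-orbit leave all g-products
    unchanged and move x between two f-orbits.  Such moves compose along a
    chain of orbits, so a factor can be moved between any two f-orbits. *)
Lemma orbit_prod_transfer (x : k) u v : x != 0 ->
  exists2 lam : E -> k, forall w, lam w != 0 &
    (forall w, orbit_prod f lam w =
       (if fconnect f w u then x else 1) * (if fconnect f w v then x^-1 else 1)) /\
    (forall w, orbit_prod g lam w = 1).
Proof.
move=> x0; have sf := fconnect_sym fI; have sg := fconnect_sym gI.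
have cancel_if b : (if b then x else 1) * (if b then x^-1 else 1) = 1.
  by case: b; rewrite ?mulr1 // mulfV.
have if_neq0 (b : bool) : ((if b then x else 1) != 0) && ((if b then x^-1 else 1) != 0).
  by case: b; rewrite ?oner_eq0 ?invr_eq0 ?x0.
have /connectP[p pP ->] := fg_conn u v.
elim: p u pP => [|y p IH] u /=.
  move=> _; exists (fun=> 1) => [w|]; first exact: oner_neq0.
  by split=> w; rewrite orbit_prod1 ?cancel_if.
case/andP => uy /IH[lam lam0 [lf lg]].
case/orP: uy => /eqP e.
  exists lam => //; split=> // w; rewrite lf -e.
  by rewrite (same_connect_r sf (fconnect1 f u)).
exists (fun w => (if w == u then x else 1) * (if w == y then x^-1 else 1) * lam w).
  by move=> w; have /andP[] := if_neq0 (w == u); have /andP[] := if_neq0 (w == y) => *;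
     rewrite !mulf_neq0.
split=> w; rewrite !orbit_prodM !orbit_prod_point.
  rewrite lf mulrA; congr (_ * _).
  by rewrite -[RHS]mulr1 -mulrA; congr (_ * _); rewrite mulrC cancel_if.
by rewrite lg mulr1 -e -(same_connect_r sg (fconnect1 g u)) cancel_if.
Qed.

(** For the boundaries of black and white faces this says that the top cohomology
    of a closed connected surface has rank one: the only obstruction to
    prescribing the products over all faces is the total product. *)
Lemma orbit_prod_solve X Y :
  (forall u, X u != 0) -> (forall u, Y u != 0) ->
  (forall u, X (f u) = X u) -> (forall u, Y (g u) = Y u) ->
  \prod_(u | froots f u) X u = \prod_(u | froots g u) Y u ->
  exists2 lam : E -> k, forall u, lam u != 0
    & forall u, orbit_prod f lam u = X u /\ orbit_prod g lam u = Y u.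
Proof.
move=> X0 Y0 Xf Yg XY; have sf := fconnect_sym fI; have sg := fconnect_sym gI.
case: (pickP (@predT E)) => [u0 _|E0]; last first.
  by exists (fun=> 1) => [u|u]; [exact: oner_neq0 | have := E0 u].
pose lam1 u := if froots g u then Y u else 1.
have lam1_0 u : lam1 u != 0 by rewrite /lam1; case: ifP; rewrite ?oner_neq0.
have lam1g u : orbit_prod g lam1 u = Y u.
  rewrite orbit_prodE /lam1 -big_mkcondr (big_pred1 (froot g u)) ?froot_invariant //.
  move=> v /=; apply/andP/eqP => [[uv /eqP <-]|->].
    by rewrite (fingraph.rootP sg uv).
  by rewrite connect_root (roots_root sg).
pose Z u := X u / orbit_prod f lam1 u.
have Z0 u : Z u != 0 by rewrite mulf_neq0 ?invr_eq0 // orbit_prod_neq0.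
have Zf u : Z (f u) = Z u.
  rewrite /Z Xf !orbit_prodE; congr (_ / _); apply: eq_bigl => v.
  by rewrite (same_connect sf (fconnect1 f u)).
(* The products over g-orbits are right for lam1; Z is the defect over f-orbits. *)
have ZE : \prod_(u | froots f u) Z u = 1.
  rewrite big_split /= XY prodfV.
  have -> : \prod_(u | froots f u) orbit_prod f lam1 u = \prod_(u | froots g u) Y u.
    rewrite [RHS]big_mkcond -(@orbit_prod_froots f _ predT) //.
    by apply: eq_bigl => u; rewrite andbT.
  by rewrite mulfV //; apply/prodf_neq0 => u _.
have /fin_all_exists2[mu mu0 muP] : forall r, exists2 lam : E -> k,
    forall w, lam w != 0 &
    (forall w, orbit_prod f lam w =
       (if fconnect f w r then Z r else 1) * (if fconnect f w u0 then (Z r)^-1 else 1)) /\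
    (forall w, orbit_prod g lam w = 1).
  by move=> r; apply: orbit_prod_transfer.
(* All defects are moved to the orbit of u0, where they cancel by ZE. *)
pose lam2 u := \prod_(r | froots f r) mu r u.
exists (fun u => lam1 u * lam2 u) => [u|u].
  by rewrite mulf_neq0 //; apply/prodf_neq0 => r _.
have lam2E h : orbit_prod h lam2 u = \prod_(r | froots f r) orbit_prod h (mu r) u.
  by rewrite /orbit_prod exchange_big.
rewrite !orbit_prodM lam1g !lam2E; split; last first.
  by rewrite big1 ?mulr1 // => r _; rewrite (muP r).2.
rewrite (eq_bigr _ (fun r _ => (muP r).1 u)) big_split /=.
rewrite [X in _ * (_ * X)](_ : _ = 1) ?mulr1; last first.
  case: (fconnect f u u0); last exact: big1_eq.
  by rewrite prodfV ZE invr1.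
rewrite -big_mkcondr (big_pred1 (froot f u)) /=; last first.
  move=> r /=; apply/andP/eqP => [[/eqP rr ur]|->].
    by rewrite -rr -(fingraph.rootP sf ur).
  by rewrite connect_root (roots_root sf).
by rewrite froot_invariant // /Z mulrC divfK // orbit_prod_neq0.
Qed.

End TwoPermutations.
End OrbitProducts.

(** * Cycles that follow a turning rule *)
Section OrbitCycles.
Variable Q : quiver.
Implicit Types (u v : arrow Q) (c : cyc_path Q).

Record turn_rule := TurnRule {
  turn :> arrow Q -> arrow Q;
  turn_inj : injective turn;
  turn_src : forall u, src (turn u) = tgt u }.
Implicit Types f g : turn_rule.

(** Words list the last traversed arrow first, hence the reversals. *)
Lemma chain_src_traject f u n i :
  chain_src i (rev (traject f u n.+1)) = src u.
Proof. by rewrite /chain_src trajectS rev_cons map_rcons last_rcons. Qed.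

Lemma chain_traject f u n : chain (src (iter n f u)) (rev (traject f u n)).
Proof.
elim: n => //= n IH; rewrite -/(traject f u n.+1) trajectSr rev_rcons /=.
by rewrite turn_src eqxx.
Qed.

Lemma orbit_path_subproof f u : let q := (src u, rev (orbit f u)) in chain q.1 q.2.
Proof.
have := chain_traject f u (order f u); rewrite /= (iter_order (@turn_inj f)) //.
Qed.

Lemma orbit_cycle_subproof f u :
  is_cyclic (Sub (src u, rev (orbit f u)) (orbit_path_subproof f u)).
Proof.
rewrite /is_cyclic /psrc /ptgt /pword /= /orbit -orderSpred chain_src_traject eqxx.
by rewrite -size_eq0 size_rev size_traject.
Qed.

Definition orbit_cycle f u : cyc_path Q := Sub _ (orbit_cycle_subproof f u).

Definition orbit_class f u : cyc_class Q := \pi_(cyc_class Q) (orbit_cycle f u).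

Lemma cword_orbit f u : cword (orbit_cycle f u) = rev (orbit f u).
Proof. by []. Qed.

Lemma pi_eqP c c' :
  reflect (exists n, cword c' = rot n (cword c)) (\pi_(cyc_class Q) c == \pi c').
Proof. by rewrite eqmodE; apply: rot_eqP. Qed.

Lemma perm_repr c : perm_eq (cword (repr (\pi_(cyc_class Q) c))) (cword c).
Proof.
have /pi_eqP[n ->] : \pi_(cyc_class Q) (repr (\pi_(cyc_class Q) c)) == \pi c.
  by rewrite reprK.
by rewrite perm_sym perm_rot.
Qed.

Lemma orbit_class_weight (k : fieldType) (lam : arrow Q -> k) f u :
  class_weight lam (orbit_class f u) = orbit_prod f lam u.
Proof.
rewrite /class_weight (perm_big _ (perm_repr _)) /= cword_orbit.
by apply: perm_big; rewrite perm_rev.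
Qed.

Lemma mem_orbit_class f u v :
  (v \in cword (repr (orbit_class f u))) = fconnect f u v.
Proof. by rewrite (perm_mem (perm_repr _)) cword_orbit mem_rev fconnect_orbit. Qed.

(** A class of cycles without repeated letters determines the successor of each
    of its letters, so cycles following different rules are told apart at any
    letter where the rules differ. *)
Lemma orbit_class_inj f g u v : orbit_class f u = orbit_class g v ->
  fconnect g v u /\ f u = g u.
Proof.
move/eqP/pi_eqP => [n]; rewrite !cword_orbit => /(congr1 rev).
rewrite rev_rot !revK => e.
have ug : u \in orbit g v by rewrite e mem_rotr in_orbit.
split; first by rewrite fconnect_orbit.
have /eqP -> := next_cycle (cycle_orbit (@turn_inj f) u) (in_orbit f u).
have /eqP -> := next_cycle (cycle_orbit (@turn_inj g) v) ug.
by rewrite e next_rotr // orbit_uniq.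
Qed.

Lemma cycle_orbit_class f c u : uniq (cword c) -> fcycle f (rev (cword c)) ->
  u \in cword c -> \pi_(cyc_class Q) c = orbit_class f u.
Proof.
move=> Uc fc uc; apply/eqP/pi_eqP; rewrite cword_orbit.
have [||i ->] := @orbit_rot_cycle _ f (rev (cword c)) fc _ u _.
- by rewrite rev_uniq.
- by rewrite mem_rev.
rewrite rev_rot revK.
by exists (size (cword c) - i)%N; rewrite /rotr.
Qed.

Lemma eq_orbit_class f u v : fconnect f u v -> orbit_class f u = orbit_class f v.
Proof.
move=> uv; apply: cycle_orbit_class; rewrite cword_orbit.
- by rewrite rev_uniq orbit_uniq.
- by rewrite revK; apply: cycle_orbit; apply: turn_inj.
- by rewrite mem_rev -fconnect_orbit.
Qed.

Lemma orbit_class_chordless f u :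
  (forall b v w, fconnect f u v -> fconnect f u w ->
     tgt b = tgt v -> src b = src w -> v = w) ->
  class_chordless (orbit_class f u).
Proof.
move=> H; rewrite class_chordlessE; apply/chordlessP; rewrite cword_orbit.
split=> [|b v w]; first by rewrite rev_uniq orbit_uniq.
by rewrite !mem_rev -!fconnect_orbit => *; apply: (H b).
Qed.

Lemma cycle_cword c : cycle (fun u v => src v == tgt u) (rev (cword c)).
Proof.
rewrite rev_cycle.
have : chain (ptgt (val c)) (cword c) := valP (val c).
have /andP[w0 /eqP] := valP c; rewrite /psrc -/(cword c).
case: (cword c) => [|a w] //; rewrite /chain_src /= last_map => e /andP[/eqP ta].
rewrite rcons_path e ta eqxx andbT => {e ta w0}.
by elim: w a => //= b w IH a /andP[/eqP-> /IH->]; rewrite eqxx.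
Qed.

End OrbitCycles.

(** * Indices modulo three *)
Section ThreeIndices.
Implicit Types i j : 'I_3.

Lemma ordSS i : ordS (ordS i) = ord_pred i.
Proof. by apply: val_inj; case: i => [[|[|[|]]]]. Qed.

Lemma ord_predP i : ord_pred (ord_pred i) = ordS i.
Proof. by apply: val_inj; case: i => [[|[|[|]]]]. Qed.

Lemma ordS_neq i : (ordS i == i) = false.
Proof. by apply/eqP => /(congr1 val); case: i => [[|[|[|]]]]. Qed.

Lemma ord_pred_neq i : (ord_pred i == i) = false.
Proof. by apply/eqP => /(congr1 val); case: i => [[|[|[|]]]]. Qed.

Lemma ord_pred_neqS i : (ord_pred i == ordS i) = false.
Proof. by apply/eqP => /(congr1 val); case: i => [[|[|[|]]]]. Qed.

Lemma ord3P i j : [\/ j = i, j = ordS i | j = ord_pred i].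
Proof.
case: i j => [[|[|[|//]]] ?] [[|[|[|//]]] ?];
  by [apply: Or31; apply: val_inj | apply: Or32; apply: val_inj
     | apply: Or33; apply: val_inj].
Qed.

Lemma sum3 i (h : 'I_3 -> nat) :
  (\sum_j h j = h i + h (ordS i) + h (ord_pred i))%N.
Proof.
rewrite (bigD1 i) //= (bigD1 (ordS i)) /= ?ordS_neq // (bigD1 (ord_pred i)) /=.
  rewrite big1 ?addn0 ?addnA // => j; case: (ord3P i j) => ->;
  by rewrite ?eqxx ?andbF.
by rewrite ord_pred_neq ord_pred_neqS.
Qed.

End ThreeIndices.

(** * Corners of triangles and punctures *)
Section Coordinates.
Variables (T : triangle_gluing) (n : nat).
Hypothesis noloops : no_loop_arcs T.
Hypothesis val3 : valence_ge3 T.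

Local Notation Q := (surface_quiver T n.+1).
Definition tcorner : finType := (triangle T * 'I_3)%type.
Implicit Types (c : tcorner) (u v w : arrow Q).

Definition cnext c : tcorner := (c.1, ordS c.2).
Definition cprev c : tcorner := (c.1, ord_pred c.2).
(** Crossing the arc that runs from the corner c to the next corner of its
    triangle leads to the adjacent corner at the same puncture; this inverts
    corner_rot. *)
Definition ccross c : tcorner :=
  let s := glue (c.1, ord_pred c.2) in (s.1, ord_pred s.2).

Lemma cnextK : cancel cnext cprev.
Proof. by case=> t i; rewrite /cnext /cprev /= ordSK. Qed.

Lemma cprevK : cancel cprev cnext.
Proof. by case=> t i; rewrite /cnext /cprev /= ord_predK. Qed.

Lemma cnextS c : cnext (cnext c) = cprev c.
Proof. by rewrite /cnext /cprev /= ordSS. Qed.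

Lemma cprevP c : cprev (cprev c) = cnext c.
Proof. by rewrite /cnext /cprev /= ord_predP. Qed.

Lemma corner_rotK : cancel (@corner_rot T) ccross.
Proof.
case=> t i; rewrite /ccross /corner_rot /= ordSK.
by case E : (glue (t, ordS i)) => [t' j] /=; rewrite -E glueK /= ordSK.
Qed.

Lemma ccrossK : cancel ccross (@corner_rot T).
Proof.
case=> t i; rewrite /ccross /corner_rot /= ord_predK.
by case E : (glue (t, ord_pred i)) => [t' j] /=; rewrite -E glueK /= ord_predK.
Qed.

Lemma ccross_inj : injective ccross.
Proof. exact: can_inj ccrossK. Qed.

(** Crossing an arc back and forth; it expresses that glue is an involution. *)
Lemma cross_quad c : ccross (cprev (ccross (cprev c))) = c.
Proof.
rewrite /ccross /cprev /= !ord_predP.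
case E : (glue (c.1, ordS c.2)) => [t' j] /=.
by rewrite ord_predK -E glueK /= ordSK; case: c {E}.
Qed.

Definition puncture c : tcorner := froot (@corner_rot T) c.

Lemma puncture_eq c c' : (puncture c == puncture c') = fconnect (@corner_rot T) c c'.
Proof. exact/(root_connect (fconnect_sym (@corner_rot_inj T))). Qed.

Lemma puncture_cross c : puncture (ccross c) = puncture c.
Proof. by apply/eqP; rewrite puncture_eq -{2}[c]ccrossK fconnect1. Qed.

Lemma puncture_cprev_next c : puncture (cprev c) <> puncture (cnext c).
Proof.
case: c => t i; have /negP := noloops t i; rewrite -puncture_eq => H e; apply: H.
exact/eqP/esym.
Qed.

Lemma puncture_next c : puncture (cnext c) <> puncture c.
Proof. by have := @puncture_cprev_next (cprev c); rewrite cprevP cprevK. Qed.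

Lemma puncture_prev c : puncture (cprev c) <> puncture c.
Proof. by have := @puncture_cprev_next (cnext c); rewrite cnextK cnextS => /nesym. Qed.

(** No arc is a loop, so the corners of a triangle are at distinct punctures. *)
Lemma same_corner c c' : c.1 = c'.1 -> puncture c = puncture c' -> c = c'.
Proof.
case: c c' => t i [_ j] /= <-.
have [->//|->|->] := ord3P i j.
  by move/esym/(@puncture_next (t, i)).
by move/esym/(@puncture_prev (t, i)).
Qed.

(** Otherwise the puncture would have valence one. *)
Lemma ccross_tri c : (ccross c).1 <> c.1.
Proof.
move=> /same_corner/(_ (puncture_cross c)) e.
have := val3 c; rewrite leqNgt; case/negP.
have fc : fcycle (@corner_rot T) [:: c] by rewrite /= -{1}e ccrossK eqxx.
by apply: leq_ltn_trans (order_le_cycle fc (mem_head _ _)) _.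
Qed.

(** Otherwise two steps around the puncture would lead back to c, and its valence
    would be at most two. *)
Lemma ccross2_tri c : (ccross (ccross c)).1 <> c.1.
Proof.
move=> /same_corner; rewrite !puncture_cross => /(_ erefl) e.
have := val3 c; rewrite leqNgt; case/negP.
have fc : fcycle (@corner_rot T) [:: c; ccross c].
  by rewrite /= -{1}e !ccrossK !eqxx.
by apply: leq_ltn_trans (order_le_cycle fc (mem_head _ _)) _.
Qed.

(** * Arrows in barycentric coordinates *)

(** An arrow turns around a corner c of its triangle.  It is recorded as
    (c, (x, y, z)), where x, y, z are the coordinates of its black triangle at c,
    at the next and at the previous corner.  Its source and target are the points
    (x+1, y, z+1) and (x+1, y+1, z). *)
Definition coords : Type := tcorner * (nat * nat * nat).
Implicit Types a : coords.

Lemma coords_eq c c' (x y z x' y' z' : nat) :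
  (c, (x, y, z)) = (c', (x', y', z')) :> coords -> [/\ c = c', x = x', y = y' & z = z'].
Proof.
move=> e; split; [exact: (congr1 fst e) | exact: (congr1 (fun a : coords => a.2.1.1) e)
  | exact: (congr1 (fun a : coords => a.2.1.2) e) | exact: (congr1 (fun a : coords => a.2.2) e)].
Qed.

Definition center u : tcorner := (u.1.1, ord_pred u.2).
Definition coord_of u : coords :=
  (center u, (val u.1.2 (ord_pred u.2) : nat, val u.1.2 u.2 : nat,
              val u.1.2 (ordS u.2) : nat)).

Definition csum a : nat := a.2.1.1 + a.2.1.2 + a.2.2.

Lemma black0_subproof :
  ((\sum_(i < 3) ([ffun j : 'I_3 => inord (if j == ord0 then n else 0) : 'I_n.+1] i : nat)).+1 == n.+1)%N.
Proof. by rewrite (sum3 ord0) !ffunE /= !inordK // !addn0. Qed.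
Definition black0 : black n.+1 := Sub (_ : {ffun _}) black0_subproof.

Definition mk_black (h : 'I_3 -> nat) : black n.+1 :=
  insubd black0 [ffun j => inord (h j)].

Lemma mk_blackE h i : (h i + h (ordS i) + h (ord_pred i) = n)%N ->
  forall j, val (mk_black h) j = h j :> nat.
Proof.
move=> hn.
have hle j : (h j < n.+1)%N by case: (ord3P i j) => ->; lia.
have ok : ((\sum_j ([ffun j => inord (h j) : 'I_n.+1] j : nat)).+1 == n.+1)%N.
  by rewrite (sum3 i) !ffunE !inordK // hn.
by move=> j; rewrite /mk_black val_insubd ok ffunE inordK.
Qed.

Definition arrow_of a : arrow Q :=
  (a.1.1, mk_black (fun j => if j == a.1.2 then a.2.1.1
                             else if j == ordS a.1.2 then a.2.1.2 else a.2.2),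
   ordS a.1.2).

Lemma coord_sum u : csum (coord_of u) = n.
Proof.
have := valP u.1.2; rewrite (sum3 (ord_pred u.2)) ord_predK ord_predP eqSS.
by move/eqP.
Qed.

Lemma arrow_ofK a : csum a = n -> coord_of (arrow_of a) = a.
Proof.
case: a => [[t i] [[x y] z]] s; rewrite /coord_of /arrow_of /= /center /= ordSK ordSS.
by rewrite !(@mk_blackE _ i) !(ordS_neq, ord_pred_neq, ord_pred_neqS, eqxx).
Qed.

Lemma coord_of_inj : injective coord_of.
Proof.
case=> [[t b] j] [[t' b'] j'] e.
have := congr1 (fun a : coords => a.1.1) e; rewrite /= => <-.
have := congr1 (fun a : coords => a.1.2) e; rewrite /= => /ord_pred_inj ej.
subst j'; have := congr1 snd e; rewrite /= => -[ex ey ez].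
congr (_, _, _); apply/val_inj/ffunP => i; apply: val_inj.
by case: (ord3P j i) => ->.
Qed.

Lemma coord_ofK u : arrow_of (coord_of u) = u.
Proof. by apply: coord_of_inj; rewrite arrow_ofK ?coord_sum. Qed.

(** The three continuations of an arrow: along its black triangle, straight ahead,
    and along the white face on its other side.  When z = 0 the target lies on an
    arc, and both a straight continuation and a white turn cross it. *)
Definition coordB a : coords := let: (c, (x, y, z)) := a in (cnext c, (y, z, x)).
Definition coordS a : coords := let: (c, (x, y, z)) := a in
  if z is z'.+1 then (c, (x, y.+1, z')) else (ccross c, (x, 0, y)).
Definition coordW a : coords := let: (c, (x, y, z)) := a in
  if z is z'.+1 then (cprev c, (z', x.+1, y)) else (ccross c, (x, 0, y)).

Lemma coordB_sum a : csum (coordB a) = csum a.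
Proof. by case: a => [? [[x y] z]]; rewrite /csum /=; lia. Qed.
Lemma coordS_sum a : csum (coordS a) = csum a.
Proof. by case: a => [? [[x y] [|z]]]; rewrite /csum /=; lia. Qed.
Lemma coordW_sum a : csum (coordW a) = csum a.
Proof. by case: a => [? [[x y] [|z]]]; rewrite /csum /=; lia. Qed.

Definition turnB u := arrow_of (coordB (coord_of u)).
Definition turnS u := arrow_of (coordS (coord_of u)).
Definition turnW u := arrow_of (coordW (coord_of u)).

Lemma co_turnB u : coord_of (turnB u) = coordB (coord_of u).
Proof. by rewrite arrow_ofK // coordB_sum coord_sum. Qed.
Lemma co_turnS u : coord_of (turnS u) = coordS (coord_of u).
Proof. by rewrite arrow_ofK // coordS_sum coord_sum. Qed.
Lemma co_turnW u : coord_of (turnW u) = coordW (coord_of u).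
Proof. by rewrite arrow_ofK // coordW_sum coord_sum. Qed.

Lemma cnext_inj : injective cnext. Proof. exact: can_inj cnextK. Qed.
Lemma cprev_inj : injective cprev. Proof. exact: can_inj cprevK. Qed.

Lemma turnB_inj : injective turnB.
Proof.
move=> u v /(congr1 coord_of); rewrite !co_turnB => e; apply: coord_of_inj; move: e.
case: (coord_of u) (coord_of v) => [c [[x y] z]] [c' [[x' y'] z']] /coords_eq[].
by move=> /cnext_inj -> -> -> ->.
Qed.

Lemma turnS_inj : injective turnS.
Proof.
move=> u v /(congr1 coord_of); rewrite !co_turnS => e; apply: coord_of_inj; move: e.
case: (coord_of u) (coord_of v) => [c [[x y] [|z]]] [c' [[x' y'] [|z']]] /coords_eq[] //.
  by move=> /ccross_inj -> -> _ ->.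
by move=> -> -> [->] ->.
Qed.

Lemma turnW_inj : injective turnW.
Proof.
move=> u v /(congr1 coord_of); rewrite !co_turnW => e; apply: coord_of_inj; move: e.
case: (coord_of u) (coord_of v) => [c [[x y] [|z]]] [c' [[x' y'] [|z']]] /coords_eq[] //.
  by move=> /ccross_inj -> -> _ ->.
by move=> /cprev_inj -> -> [->] ->.
Qed.

(** * Vertices of the quiver glued along arcs *)
Definition src_pt u : triangle T * node n.+1 := (u.1.1, black_corner u.1.2 u.2).
Definition tgt_pt u : triangle T * node n.+1 :=
  (u.1.1, black_corner u.1.2 (ordS u.2)).

Lemma black_cornerE (a : black n.+1) k j :
  val (black_corner a k) j = (val a j + (j != k))%N :> nat.
Proof.
rewrite /black_corner /= ffunE inordK //.
by have := ltn_ord (val a j); case: (j != k) => /=; lia.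
Qed.

Lemma src_ptE u c (x y z : nat) : coord_of u = (c, (x, y, z)) ->
  [/\ (src_pt u).1 = c.1, val (src_pt u).2 c.2 = x.+1 :> nat,
   val (src_pt u).2 (ordS c.2) = y :> nat
   & val (src_pt u).2 (ord_pred c.2) = z.+1 :> nat].
Proof.
move=> /coords_eq[<- <- <- <-]; rewrite /= !black_cornerE ord_predK ord_predP eqxx addn0.
by rewrite ord_pred_neq ordS_neq !addn1.
Qed.

Lemma tgt_ptE u c (x y z : nat) : coord_of u = (c, (x, y, z)) ->
  [/\ (tgt_pt u).1 = c.1, val (tgt_pt u).2 c.2 = x.+1 :> nat,
   val (tgt_pt u).2 (ordS c.2) = y.+1 :> nat
   & val (tgt_pt u).2 (ord_pred c.2) = z :> nat].
Proof.
move=> /coords_eq[<- <- <- <-]; rewrite /= !black_cornerE ord_predK ord_predP eqxx addn0.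
by rewrite ord_pred_neqS eq_sym ordS_neq !addn1.
Qed.

Lemma node_sum (x : node n.+1) i :
  (val x i + val x (ordS i) + val x (ord_pred i) = n.+2)%N.
Proof. by have /andP[/eqP] := valP x; rewrite (sum3 i). Qed.

(** A point other than a corner lies on at most one side. *)
Lemma node_zero_uniq (x : node n.+1) i j :
  val x i = 0%N :> nat -> val x j = 0%N :> nat -> i = j.
Proof.
have /andP[_ /forallP H] := valP x; have s := node_sum x i.
move: (H i) (H (ordS i)) (H (ord_pred i)) => /eqP h1 /eqP h2 /eqP h3 xi xj.
by case: (ord3P i j) xj => -> xj //; lia.
Qed.

Lemma node_ext (x y : node n.+1) i : val x i = val y i :> nat ->
  val x (ordS i) = val y (ordS i) :> nat ->
  val x (ord_pred i) = val y (ord_pred i) :> nat -> x = y.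
Proof.
move=> e1 e2 e3; apply/val_inj/ffunP => j; apply: val_inj.
by case: (ord3P i j) => ->.
Qed.

Lemma gluedP (p q : triangle T * node n.+1) :
  reflect (exists i j, [/\ glue (p.1, i) = (q.1, j), val p.2 i = 0%N :> nat,
     val q.2 j = 0%N :> nat,
     val q.2 (ordS j) = val p.2 (ord_pred i) :> nat
     & val q.2 (ord_pred j) = val p.2 (ordS i) :> nat]) (glued p q).
Proof.
apply: (iffP existsP) => [[i /existsP[j /and5P[/eqP ? /eqP ? /eqP ? /eqP e1 /eqP e2]]]|].
  by exists i, j; split; rewrite // ?e1 ?e2.
case=> i [j [e1 e2 e3 e4 e5]]; exists i; apply/existsP; exists j.
by rewrite e1 e2 e3 -!(inj_eq val_inj) /= e4 e5 !eqxx.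
Qed.

(** A point on an arc has a single partner, so the generated equivalence relation
    adds nothing to gluing itself. *)
Lemma glued_uniq p q r : @glued T n.+1 p q -> glued q r -> p = r.
Proof.
case/gluedP=> i [j [e pi qj e1 e2]] /gluedP[j' [i' [e' qj' ri e1' e2']]].
have ej := node_zero_uniq qj qj'; subst j'.
rewrite -e glueK in e'; have e0 := congr1 fst e'; have ei := congr1 snd e'.
rewrite /= in e0 ei; subst i'.
rewrite [p]surjective_pairing [r]surjective_pairing -e0; congr pair.
by apply: (node_ext (i := i)); rewrite ?pi ?ri // ?e1' ?e2' ?e1 ?e2.
Qed.

Lemma node_eqP (p q : triangle T * node n.+1) :
  reflect (p = q \/ glued p q)
          (\pi_(surface_node T n.+1) p == \pi_(surface_node T n.+1) q).
Proof.
rewrite eqmodE /=; apply: (iffP idP) => [|[->|/connect1//]]; last exact: connect0.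
case/connectP=> s + ->; elim: s p => [|r s IH] p /=; first by left.
case/andP=> pr /IH[<-|rq]; first by right.
by left; apply: glued_uniq pr rq.
Qed.

Lemma srcE u : src u = \pi_(surface_node T n.+1) (src_pt u) :> vert Q.
Proof. by []. Qed.
Lemma tgtE u : tgt u = \pi_(surface_node T n.+1) (tgt_pt u) :> vert Q.
Proof. by []. Qed.

(** * One and two steps along a path *)
Definition step u v : Prop := [\/ v = turnB u, v = turnW u | v = turnS u].

(** The six arrows at an interior point alternate between incoming and outgoing,
    which leaves two sharp turns and the straight continuation.  A point on an
    arc has one incoming and one outgoing arrow in each of its two triangles. *)
Lemma tgt_src_step u v : tgt u = src v :> vert Q -> step u v.
Proof.
rewrite tgtE srcE /step => /eqP/node_eqP.
have eco (w w' : arrow Q) : coord_of w = coord_of w' -> w = w' by apply: coord_of_inj.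
case Eu : (coord_of u) => [[t i] [[x y] z]]; case Ev : (coord_of v) => [[t' i'] [[x' y'] z']] /=.
case: (src_ptE Ev) (tgt_ptE Eu) => [tv v1 v2 v3] [tu u1 u2 u3] [e|/gluedP[k [l [e k0 l0 e1 e2]]]].
  have et : t' = t := etrans (esym tv) (etrans (congr1 fst (esym e)) tu).
  move: u1 u2 u3; rewrite e; subst t'.
  have [ei|ei|ei] := ord3P i i'; subst i'; rewrite ?ordSS ?ordSK ?ord_predK ?ord_predP in v1 v2 v3;
    rewrite ?v1 ?v2 ?v3 => u1 u2 u3.
  - apply: Or33; apply: eco; rewrite co_turnS Eu Ev -u3 /=.
    by congr (_, (_, _, _)); lia.
  - apply: Or31; apply: eco; rewrite co_turnB Eu Ev /=.
    by congr (_, (_, _, _)); lia.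
  - apply: Or32; apply: eco; rewrite co_turnW Eu Ev -u3 /=.
    by congr (_, (_, _, _)); lia.
have ek : k = ord_pred i.
  by case: (ord3P i k) k0 => ->; rewrite ?u1 ?u2.
have el : l = ordS i'.
  by case: (ord3P i' l) l0 => ->; rewrite ?v1 ?v3.
subst k l; have y0 : y' = 0%N := etrans (esym v2) l0.
move: e1 e2; rewrite ?ordSS ?ordSK ?ord_predK ?ord_predP v1 v3 u1 u2 => e1 e2.
apply: Or33; apply: eco; rewrite co_turnS Eu Ev -u3 k0 /=.
move: e; rewrite tu tv => e; rewrite /ccross /= e /= ordSK.
by congr (_, (_, _, _)); lia.
Qed.

Lemma tgt_src u v : (src_pt v).1 = (tgt_pt u).1 ->
  (exists i, [/\ val (src_pt v).2 i = val (tgt_pt u).2 i :> nat,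
     val (src_pt v).2 (ordS i) = val (tgt_pt u).2 (ordS i) :> nat
   & val (src_pt v).2 (ord_pred i) = val (tgt_pt u).2 (ord_pred i) :> nat]) ->
  src v = tgt u :> vert Q.
Proof.
move=> e [i [e1 e2 e3]]; rewrite srcE tgtE; congr (\pi_(_) _).
by rewrite [src_pt v]surjective_pairing e (node_ext e1 e2 e3) -surjective_pairing.
Qed.

Lemma tgt_src_cross u v c (x y : nat) :
  coord_of u = (c, (x, y, 0%N)) -> coord_of v = (ccross c, (x, 0%N, y)) ->
  src v = tgt u :> vert Q.
Proof.
case: c => t i Eu; case E : (glue (t, ord_pred i)) => [t' j] Ev.
have {}Ev : coord_of v = ((t', ord_pred j), (x, 0%N, y)) by rewrite Ev /ccross /= E.
have [tv v1 v2 v3] := src_ptE Ev; have [tu u1 u2 u3] := tgt_ptE Eu.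
rewrite srcE tgtE; apply/esym/eqP/node_eqP; right.
apply/gluedP; exists (ord_pred i), j; rewrite tu tv E; split; first by [].
- exact: u3.
- by rewrite -[j in LHS]ord_predK.
- by rewrite -ord_predP ord_predP -{1}[j]ord_predK ordSS v3 ord_predP u2.
- by rewrite v1 ord_predK u1.
Qed.

Lemma turnB_src u : src (turnB u) = tgt u :> vert Q.
Proof.
have := co_turnB u; case Eu : (coord_of u) => [[t i] [[x y] z]] Ev.
have [tv v1 v2 v3] := src_ptE Ev; have [tu u1 u2 u3] := tgt_ptE Eu.
apply: tgt_src; first by rewrite tu tv.
have {}v2 : val (src_pt (turnB u)).2 (ord_pred i) = z :> nat by rewrite -ordSS.
have {}v3 : val (src_pt (turnB u)).2 i = x.+1 :> nat by rewrite -[i]ordSK.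
by exists i; split; [rewrite v3 u1 | rewrite v1 u2 | rewrite v2 u3].
Qed.

Lemma turnS_src u : src (turnS u) = tgt u :> vert Q.
Proof.
have := co_turnS u; case Eu : (coord_of u) => [[t i] [[x y] [|z]]] Ev.
  exact: tgt_src_cross Eu Ev.
have [tv v1 v2 v3] := src_ptE Ev; have [tu u1 u2 u3] := tgt_ptE Eu.
apply: tgt_src; first by rewrite tu tv.
by exists i; split; [rewrite v1 u1 | rewrite v2 u2 | rewrite v3 u3].
Qed.

Lemma turnW_src u : src (turnW u) = tgt u :> vert Q.
Proof.
have := co_turnW u; case Eu : (coord_of u) => [[t i] [[x y] [|z]]] Ev.
  exact: tgt_src_cross Eu Ev.
have [tv v1 v2 v3] := src_ptE Ev; have [tu u1 u2 u3] := tgt_ptE Eu.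
apply: tgt_src; first by rewrite tu tv.
have {}v2 : val (src_pt (turnW u)).2 i = x.+1 :> nat by rewrite -[i]ord_predK.
have {}v3 : val (src_pt (turnW u)).2 (ordS i) = y.+1 :> nat by rewrite -ord_predP.
by exists i; split; [rewrite v2 u1 | rewrite v3 u2 | rewrite v1 u3].
Qed.

Lemma cnext_neq c : cnext c <> c.
Proof. by move=> e; apply: (@puncture_next c); rewrite e. Qed.

Lemma cprev_neq c : cprev c <> c.
Proof. by move=> e; apply: (@puncture_prev c); rewrite e. Qed.

Lemma cnext_cprev_neq c : cnext c <> cprev c.
Proof. by rewrite -cnextS => /cnext_inj/esym/cnext_neq. Qed.

Definition tstep a a' : Prop := [\/ a' = coordB a, a' = coordW a | a' = coordS a].

Lemma stepE u v : step u v <-> tstep (coord_of u) (coord_of v).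
Proof.
rewrite /step /tstep -co_turnB -co_turnS -co_turnW.
by split=> -[e|e|e]; [apply: Or31|apply: Or32|apply: Or33|apply: Or31|apply: Or32|apply: Or33];
  rewrite ?e //; apply: coord_of_inj.
Qed.

Lemma ccross_contra c (d d' : tcorner) : d = d' -> d.1 = (ccross c).1 -> d'.1 = c.1 -> False.
Proof. by move=> -> e1 e2; apply: (@ccross_tri c); rewrite -e1. Qed.

Lemma ccross2_contra c (d d' : tcorner) :
  d = d' -> d.1 = (ccross (ccross c)).1 -> d'.1 = c.1 -> False.
Proof. by move=> -> e1 e2; apply: (@ccross2_tri c); rewrite -e1. Qed.

(* Refutes an equality between two corners of one triangle, or between corners of
   triangles that are one or two arcs apart around a puncture. *)
Ltac corner_contra e :=
  try (apply ccross_inj in e);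
  match type of e with
  | context [ccross (ccross ?c)] =>
      first [ exact (@ccross2_contra c _ _ e erefl erefl)
            | exact (@ccross2_contra c _ _ (esym e) erefl erefl) ]
  | context [ccross ?c] =>
      first [ exact (@ccross_contra c _ _ e erefl erefl)
            | exact (@ccross_contra c _ _ (esym e) erefl erefl) ]
  | _ => move: e; rewrite ?cnextS ?cprevP ?cnextK ?cprevK;
         let e' := fresh in move=> e';
         first [ exact: (cnext_neq e') | exact: (cprev_neq e')
               | exact: (cnext_cprev_neq e') | exact: (cnext_neq (esym e'))
               | exact: (cprev_neq (esym e')) | exact: (cnext_cprev_neq (esym e')) ]
  end.

Ltac stepEntra :=
  let e := fresh "e" in let e1 := fresh in let e2 := fresh in let e3 := fresh in
  move=> e; exfalso; move: e => /coords_eq[e e1 e2 e3];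
  first [lia | corner_contra e].

(** If b is a chord of an orbit of a turning rule, from the target of v to the
    source of f w, then v, b, f w are consecutive steps.  So an orbit is
    chordless as soon as any two steps leading from v back to the orbit end at
    f (f v).  The next lemmas check this for each kind of orbit by going
    through the nine pairs of steps and comparing coordinates. *)
Lemma tstep2_black a a1 a2 : tstep a a1 -> tstep a1 a2 ->
  [\/ a2 = a, a2 = coordB a | a2 = coordB (coordB a)] ->
  a1 = coordB a /\ a2 = coordB (coordB a).
Proof.
case: a => [c [[x y] z]]; case=> [->|->|->].
- case=> -> /=; first by [].
  + by case: x => [|x] []; stepEntra.
  + by case: x => [|x] []; stepEntra.
- case: z => [|z]; case=> -> /=.
  + by case; stepEntra.
  + by case: y => [|y] []; stepEntra.
  + by case: y => [|y] []; stepEntra.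
  + by case; stepEntra.
  + by case: y => [|y] []; stepEntra.
  + by case: y => [|y] []; stepEntra.
- case: z => [|z]; case=> -> /=.
  + by case; stepEntra.
  + by case: y => [|y] []; stepEntra.
  + by case: y => [|y] []; stepEntra.
  + by case; stepEntra.
  + by case: z => [|z] []; stepEntra.
  + by case: z => [|z] []; stepEntra.
Qed.

Lemma ccross_quad c : ccross (cprev (ccross c)) = cnext c.
Proof. by rewrite -{1}[c]cnextK cross_quad. Qed.

Lemma tstep2_white a a1 a2 : tstep a a1 -> tstep a1 a2 ->
  (0 < a.2.1.2)%N -> (0 < a.2.2)%N ->
  [\/ a2 = a, a2 = coordW a | a2 = coordW (coordW a)] -> a2 = coordW (coordW a).
Proof.
case: a => [c [[x [|y]] [|z]]] //; case=> [->|->|->].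
- case=> -> /= _ _.
  + by case=> //; stepEntra.
  + by case: x => [|x] []; stepEntra.
  + by case: x => [|x] []; stepEntra.
- case=> -> /= _ _.
  + by case; stepEntra.
  + by [].
  + by case; stepEntra.
- case=> -> /= _ _.
  + by case; stepEntra.
  + by case: z => [|z] []; stepEntra.
  + by case: z => [|z] []; stepEntra.
Qed.

Lemma tstep2_quad a a1 a2 : tstep a a1 -> tstep a1 a2 ->
  (a.2.1.2 == 0%N) != (a.2.2 == 0%N) ->
  a2 = a \/ [\/ a2 = coordW a, a2 = coordW (coordW a)
              | a2 = coordW (coordW (coordW a))] ->
  a2 = coordW (coordW a).
Proof.
case: a => [c [[x [|y]] [|z]]] //; case=> [->|->|->]; case=> ->; rewrite /= ?ccross_quad => _.
all: try by case=> [|[]]; stepEntra.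
all: try by case: x => [|x]; case=> [|[]]; stepEntra.
all: try by case: y => [|y]; case=> [|[]]; stepEntra.
all: try by case: z => [|z]; case=> [|[]]; stepEntra.
all: by [].
Qed.

(** The puncture and the distance, which determine a circle. *)
Definition circ_inv a : tcorner * nat := (puncture a.1, a.2.1.1).

Lemma circ_inv_eq c c' (x y z x' y' z' : nat) :
  circ_inv (c, (x, y, z)) = circ_inv (c', (x', y', z')) ->
  puncture c = puncture c' /\ x = x'.
Proof. by move=> e; split; [exact: (congr1 fst e) | exact: (congr1 snd e)]. Qed.

Ltac circ_contra :=
  let e := fresh in let e' := fresh in
  case/circ_inv_eq => e e'; exfalso;
  first
    [ lia
    | match type of e with
      | puncture (cnext (ccross ?c)) = _ =>
          exact (@puncture_next (ccross c) (etrans e (esym (puncture_cross c))))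
      | puncture (cprev (ccross ?c)) = _ =>
          exact (@puncture_prev (ccross c) (etrans e (esym (puncture_cross c))))
      | _ => move: e; rewrite ?puncture_cross ?cnextS ?cprevP ?cnextK ?cprevK => e;
             first [ exact: (puncture_next e) | exact: (puncture_prev e) ]
      end ].

Lemma tstep2_circle a a1 a2 : tstep a a1 -> tstep a1 a2 ->
  circ_inv a2 = circ_inv a -> a1 = coordS a /\ a2 = coordS (coordS a).
Proof.
case: a => [c [[x y] [|z]]]; case=> [->|->|->]; case=> -> /=.
all: try circ_contra.
all: try by [].
all: try by case: x => [|x]; circ_contra.
all: try by case: z => [|z]; circ_contra.
all: try by case: z => [|z]; last circ_contra.
all: by case: y => [|y]; first [by [] | circ_contra].
Qed.

(** * Orbits of the turning rules are chordless *)
Lemma tstep_irr a : ~ tstep a a.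
Proof.
case: a => [c [[x y] [|z]]]; rewrite /tstep /=; case=> /coords_eq[e e1 e2 e3];
  by [lia | corner_contra e].
Qed.

Lemma surface_noloop u : src u != tgt u :> vert Q.
Proof.
by apply/eqP => /esym/tgt_src_step/stepE/tstep_irr.
Qed.

Lemma turnB3 u : turnB (turnB (turnB u)) = u.
Proof.
apply: coord_of_inj; rewrite !co_turnB; case: (coord_of u) => [c [[x y] z]] /=.
by rewrite cnextS cnextK.
Qed.

(** If v is parallel to u then it can replace u in the black triangle of u, and
    two steps in that triangle are forced. *)
Lemma surface_noparallel u v :
  src u = src v :> vert Q -> tgt u = tgt v :> vert Q -> u = v.
Proof.
move=> es et; have s1 : step (turnB (turnB u)) v.
  by apply: tgt_src_step; rewrite -turnB_src turnB3.
have s2 : step v (turnB u) by apply: tgt_src_step; rewrite turnB_src.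
move/stepE: s1 => s1; move/stepE: s2 => s2.
have [|e _] := tstep2_black s1 s2.
  by apply: Or33; rewrite -!co_turnB turnB3.
by apply: coord_of_inj; rewrite e -co_turnB turnB3.
Qed.

Definition ruleB : turn_rule Q := TurnRule turnB_inj turnB_src.
Definition ruleW : turn_rule Q := TurnRule turnW_inj turnW_src.
Definition ruleS : turn_rule Q := TurnRule turnS_inj turnS_src.

(** A chord b from the source of w to the target of v gives the two steps
    f^-1 w, b, f v. *)
Lemma step2_chordless (f : turn_rule Q) u :
  (forall v w b, fconnect f u v -> fconnect f v w -> step v b -> step b w ->
     w = f (f v)) ->
  class_chordless (orbit_class f u).
Proof.
have sf := fconnect_sym (@turn_inj _ f).
move=> H; apply: orbit_class_chordless => b v w uv uw tb sb.
apply: (@turn_inj _ f); pose v' := finv f w.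
have wE : w = f v' by rewrite (f_finv (@turn_inj _ f)).
have uv' : fconnect f u v' by rewrite (same_fconnect1_r (@turn_inj _ f)) -wE.
rewrite [in RHS]wE; apply: (H _ _ b) => //.
- rewrite -(same_fconnect1_r (@turn_inj _ f)) sf.
  by rewrite sf in uv; apply: connect_trans uv uv'.
- by apply: tgt_src_step; rewrite sb wE turn_src.
- by apply: tgt_src_step; rewrite tb turn_src.
Qed.

Lemma fconnectB u v : fconnect turnB u v ->
  [\/ v = u, v = turnB u | v = turnB (turnB u)].
Proof.
rewrite (@fconnect_cycle _ _ [:: u; turnB u; turnB (turnB u)]) ?mem_head //.
  by rewrite !inE => /or3P[]/eqP->; [apply: Or31|apply: Or32|apply: Or33].
by rewrite /= !eqxx turnB3 eqxx.
Qed.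

Lemma black_chordless u : class_chordless (orbit_class ruleB u).
Proof.
apply: step2_chordless => v w b _ /fconnectB vw /stepE s1 /stepE s2.
apply: coord_of_inj; rewrite !co_turnB; have [|_ -> //] := tstep2_black s1 s2.
by rewrite -!co_turnB; case: vw => ->; [apply: Or31|apply: Or32|apply: Or33].
Qed.

Lemma circ_invS u : circ_inv (coord_of (turnS u)) = circ_inv (coord_of u).
Proof.
by rewrite co_turnS; case: (coord_of u) => [c [[x y] [|z]]] //=;
   rewrite /circ_inv /= puncture_cross.
Qed.

Lemma circ_inv_orbit u v : fconnect turnS u v -> circ_inv (coord_of v) = circ_inv (coord_of u).
Proof.
move=> uv; symmetry.
by apply: (fconnect_invariant (f := turnS) (k := circ_inv \o coord_of)) uv => w /=;
   rewrite circ_invS eqxx.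
Qed.

Lemma circle_chordless u : class_chordless (orbit_class ruleS u).
Proof.
apply: step2_chordless => v w b _ /circ_inv_orbit vw /stepE s1 /stepE s2.
by apply: coord_of_inj; rewrite !co_turnS; apply: (tstep2_circle s1 s2 vw).2.
Qed.

(** The innermost arrows around a puncture, whose white face is the polygon
    around it. *)
Definition at_corner u := (coord_of u).2.1.2 = 0%N /\ (coord_of u).2.2 = 0%N.

Lemma turnW_corner u : at_corner u -> turnW u = turnS u /\ at_corner (turnW u).
Proof.
rewrite /at_corner => -[y0 z0]; split.
  apply: coord_of_inj; rewrite co_turnW co_turnS.
  by move: y0 z0; case: (coord_of u) => [c [[x y] z]] /= -> ->.
by rewrite co_turnW; move: y0 z0; case: (coord_of u) => [c [[x y] z]] /= -> ->.
Qed.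

Lemma corner_orbit u v : at_corner u -> fconnect turnW u v ->
  fconnect turnS u v /\ at_corner v.
Proof.
move=> u0 /iter_findex <-; elim: (findex _ _ _) => //= k [IH1 IH2].
have [e1 e2] := turnW_corner IH2; split=> //.
by rewrite e1 (connect_trans IH1) // fconnect1.
Qed.

Lemma turnW3 u : (0 < (coord_of u).2.1.2)%N -> (0 < (coord_of u).2.2)%N ->
  turnW (turnW (turnW u)) = u.
Proof.
move=> y0 z0; apply: coord_of_inj; rewrite !co_turnW; move: y0 z0.
by case: (coord_of u) => [c [[x [|y]] [|z]]] //= _ _; rewrite cprevP cprevK.
Qed.

Lemma turnW4 u : ((coord_of u).2.1.2 == 0%N) != ((coord_of u).2.2 == 0%N) ->
  turnW (turnW (turnW (turnW u))) = u.
Proof.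
move=> yz; apply: coord_of_inj; rewrite !co_turnW; move: yz.
case: (coord_of u) => [c [[x [|y]] [|z]]] //= _; rewrite ccross_quad ?cprevK ?cnextK //.
Qed.

(** The shape of the white face is read off from y and z: a triangle if both are
    positive, a quadrilateral across an arc if exactly one vanishes, and a circle
    around a puncture if both do. *)
Lemma white_chordless u : class_chordless (orbit_class ruleW u).
Proof.
apply: step2_chordless => v w b _ vw s1 s2.
have t1 := (stepE _ _).1 s1; have t2 := (stepE _ _).1 s2.
have [yz|] := boolP (((coord_of v).2.1.2 == 0%N) != ((coord_of v).2.2 == 0%N)).
  apply: coord_of_inj; rewrite !co_turnW; apply: (tstep2_quad t1 t2 yz).
  rewrite -!co_turnW; move: vw.
  rewrite (@fconnect_cycle _ _ [:: v; turnW v; turnW (turnW v);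
     turnW (turnW (turnW v))]) ?mem_head //.
    by rewrite !inE => /or4P[]/eqP->; [left|right; apply: Or31|right; apply: Or32|right; apply: Or33].
  by rewrite /= !eqxx turnW4 ?eqxx.
have [y0|y0] := eqVneq (coord_of v).2.1.2 0%N; have [z0|z0] := eqVneq (coord_of v).2.2 0%N => // _.
  have v0 : at_corner v by [].
  have [/circ_inv_orbit vw' _] := corner_orbit v0 vw.
  have [e1 e2] := turnW_corner v0; have [e3 _] := turnW_corner e2.
  rewrite /= e3 e1; apply: coord_of_inj; rewrite !co_turnS.
  exact: (tstep2_circle t1 t2 vw').2.
rewrite -!lt0n in y0 z0.
apply: coord_of_inj; rewrite !co_turnW; apply: (tstep2_white t1 t2 y0 z0).
rewrite -!co_turnW; move: vw.
rewrite (@fconnect_cycle _ _ [:: v; turnW v; turnW (turnW v)]) ?mem_head //.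
  by rewrite !inE => /or3P[]/eqP->; [apply: Or31|apply: Or32|apply: Or33].
by rewrite /= !eqxx turnW3 ?eqxx.
Qed.

(** * Chordless cycles are orbits of the turning rules *)
Lemma turnW_flat u : (coord_of u).2.2 = 0%N -> turnW u = turnS u.
Proof.
move=> z0; apply: coord_of_inj; rewrite co_turnW co_turnS; move: z0.
by case: (coord_of u) => [c [[x y] z]] /= ->.
Qed.

(** If a chordless cycle makes a black turn, the third side of the black triangle
    joins two of its vertices, so it is the next arrow: black turns propagate
    along the whole cycle.  So do sharp white turns, in a triangle for the same
    reason.  In a quadrilateral the cycle must first cross the arc, because a
    black turn is excluded, and then the fourth side closes it up.  A cycle
    without sharp turns is straight. *)
Lemma chordless_class (c : cyc_path Q) : chordless c -> exists u,
  [\/ \pi_(cyc_class Q) c = orbit_class ruleB u,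
      \pi_(cyc_class Q) c = orbit_class ruleW u
    | \pi_(cyc_class Q) c = orbit_class ruleS u /\ ((coord_of u).2.1.1 < n)%N].
Proof.
move=> /chordlessP[Uc H]; pose s := rev (cword c).
have Us : uniq s by rewrite rev_uniq.
have sE v : (v \in cword c) = (v \in s) by rewrite mem_rev.
pose nu := next s.
have nuS v : v \in s -> nu v \in s by rewrite mem_next.
have nu_src v : v \in s -> src (nu v) = tgt v :> vert Q.
  by move=> vs; apply/eqP; exact: (next_cycle (cycle_cword c) vs).
have nu_step v : v \in s -> step v (nu v).
  by move=> vs; apply: tgt_src_step; rewrite nu_src.
(* An arrow that closes up a segment of the cycle is the next arrow. *)
have close u v b : u \in s -> v \in s ->
    src b = tgt v :> vert Q -> tgt b = src u :> vert Q -> nu v = b.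
  move=> us vs sb tb; pose p := prev s u.
  have ps : p \in s by rewrite mem_prev.
  have nup : nu p = u by rewrite /nu next_prev.
  have e : p = nu v.
    by apply: (H b); rewrite ?sE ?nuS // ?nu_src // tb -nu_src // nup.
  apply: surface_noparallel; first by rewrite nu_src.
  by rewrite -e -nu_src // nup.
have everywhere (P : arrow Q -> Prop) u : u \in s -> P u ->
    (forall v, v \in s -> P v -> P (nu v)) -> forall v, v \in s -> P v.
  move=> us Pu PP v vs; have : fconnect nu u v.
    by rewrite (fconnect_cycle (cycle_next Us) us).
  move/iter_findex <-.
  suff H2 k : (iter k nu u \in s) /\ P (iter k nu u) by case: (H2 (findex nu u v)).
  by elim: k => //= k [IH1 IH2]; split; [exact: nuS | exact: PP].
have classE (f : turn_rule Q) u : u \in s -> (forall v, v \in s -> nu v = f v) ->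
    \pi_(cyc_class Q) c = orbit_class f u.
  move=> us fE; apply: cycle_orbit_class; rewrite ?sE //.
  by apply: cycle_from_next => // v vs; rewrite /= -fE.
have [u0 u0s] : exists u0, u0 \in s.
  have /andP[] := valP c; rewrite -/(cword c) /s; case: (cword c) => // a w _ _.
  by exists a; rewrite mem_rev mem_head.
have [/hasP[u us /eqP nuB]|/hasPn noB] := boolP (has (fun u => nu u == turnB u) s).
  exists u; apply: Or31; apply: classE => // v vs.
  apply: (everywhere (fun v => nu v = turnB v) u) => // w ws nw.
  rewrite {2}nw; apply: (close w) => //; rewrite ?nuS // -?nw ?turnB_src ?nw //.
  by rewrite -turnB_src turnB3.
have noB' v : v \in s -> nu v = turnB v -> False.
  by move=> vs e; have := noB v vs; rewrite e eqxx.
have [/hasP[u us /andP[/eqP nuW zu]]|/hasPn noW] :=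
    boolP (has (fun u => (nu u == turnW u) && (0 < (coord_of u).2.2)%N) s).
  exists u; apply: Or32; apply: classE => // v vs.
  pose R w := nu w = turnW w /\ ((0 < (coord_of w).2.2)%N \/
    ((0 < (coord_of (turnW w)).2.2)%N /\ nu (turnW w) = turnW (turnW w))).
  suff [] : R v by [].
  apply: (everywhere R u) => //; first by split; [|left].
  move=> w ws [nw [zw|[zw nw2]]]; last by rewrite /R nw; split; [|left].
  have ws2 := nuS _ ws; rewrite nw in ws2.
  have [y0|] := posnP (coord_of w).2.1.2; last first.
    move=> y0; rewrite /R nw; split; last first.
      by left; rewrite co_turnW; move: y0 zw; case: (coord_of w) => [? [[? ?] [|?]]].
    apply: (close w) => //; first by rewrite turnW_src.
    by rewrite -turnW_src turnW3.
  have z0 : (coord_of (turnW w)).2.2 = 0%N.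
    by rewrite co_turnW; move: y0 zw; case: (coord_of w) => [? [[? ?] [|?]]].
  have nw2 : nu (turnW w) = turnW (turnW w).
    case: (nu_step _ ws2) => // [/(noB' _ ws2) //|->]; first by rewrite (turnW_flat z0).
  have ws3 := nuS _ ws2; rewrite nw2 in ws3.
  rewrite /R nw; split=> //; right; split.
    rewrite !co_turnW; move: y0 zw.
    by case: (coord_of w) => [? [[? ?] [|?]]] //= -> _.
  apply: (close w) => //; first by rewrite turnW_src.
  rewrite -turnW_src turnW4 //.
  by move: y0 zw; case: (coord_of w) => [? [[? ?] [|?]]] //= ->.
have allS v : v \in s -> nu v = turnS v.
  move=> vs; case: (nu_step _ vs) => // [/(noB' _ vs) //|e].
  have := noW v vs; rewrite e eqxx /= -eqn0Ngt => /eqP z0.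
  by rewrite turnW_flat.
exists u0; have [xn|xn] := ltnP (coord_of u0).2.1.1 n.
  by apply: Or33; split; [exact: classE|].
apply: Or32; apply: classE => // v vs; rewrite allS //= turnW_flat //.
have : circ_inv (coord_of v) = circ_inv (coord_of u0).
  apply: (everywhere (fun v => circ_inv (coord_of v) = circ_inv (coord_of u0)) u0) => // w ws <-.
  by rewrite allS // circ_invS.
move/(congr1 snd) => e; have {}e : (coord_of v).2.1.1 = (coord_of u0).2.1.1 := e.
by have := coord_sum v; rewrite /csum; lia.
Qed.

(** * Straight orbits are the circles around punctures *)
Lemma turnS_arrow_of c (x y z : nat) : (x + y + z.+1 = n)%N ->
  turnS (arrow_of (c, (x, y, z.+1))) = arrow_of (c, (x, y.+1, z)).
Proof. by move=> s; rewrite /turnS arrow_ofK. Qed.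

Lemma turnS_cross c (x y : nat) : (x + y = n)%N ->
  turnS (arrow_of (c, (x, y, 0%N))) = arrow_of (ccross c, (x, 0%N, y)).
Proof. by move=> s; rewrite /turnS arrow_ofK // /csum /= addn0. Qed.

(** Within a triangle, a circle enters with y = 0 and leaves with z = 0. *)
Lemma turnS_level c (x y z : nat) : (x + y + z = n)%N ->
  fconnect turnS (arrow_of (c, (x, 0%N, y + z)%N)) (arrow_of (c, (x, y, z))).
Proof.
elim: y z => [|y IH] z s; first exact: connect0.
rewrite addSnnS (connect_trans (IH z.+1 _)) //; first by lia.
by rewrite -turnS_arrow_of ?fconnect1 //; lia.
Qed.

Lemma turnS_around c c' (x z : nat) : (x + z = n)%N -> puncture c = puncture c' ->
  fconnect turnS (arrow_of (c, (x, 0%N, z))) (arrow_of (c', (x, 0%N, z))).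
Proof.
move=> s /eqP; rewrite puncture_eq => /iter_findex <-.
elim: (findex _ _ _) => [|k IH]; first exact: connect0.
apply: connect_trans IH _; rewrite /= (fconnect_sym turnS_inj).
set d := iter k _ c; rewrite -{2}[d]corner_rotK -turnS_cross //.
rewrite -(same_fconnect1_r turnS_inj).
by have := @turnS_level (corner_rot d) x z 0; rewrite !addn0; apply.
Qed.

Lemma turnS_circle u v :
  puncture (center u) = puncture (center v) -> (coord_of u).2.1.1 = (coord_of v).2.1.1 ->
  fconnect turnS u v.
Proof.
have sf := fconnect_sym turnS_inj.
rewrite -[u in fconnect _ u]coord_ofK -[v in fconnect _ _ v]coord_ofK.
have := coord_sum u; have := coord_sum v.
rewrite -[center u]/((coord_of u).1) -[center v]/((coord_of v).1).
case: (coord_of u) (coord_of v) => [c [[x y] z]] [c' [[x' y'] z']]; rewrite /csum /= => s' s e ex.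
subst x'; rewrite sf; have e1 := turnS_level c s; have e2 := turnS_level c' s'.
rewrite sf; apply: connect_trans e2; rewrite sf; apply: connect_trans e1.
have -> : (y' + z' = y + z)%N by lia.
by apply: turnS_around; [lia | rewrite e].
Qed.

(** * Connectivity of the faces *)
Section Connectivity.
Hypothesis Tconn : forall t t', connect (@adjacent T) t t'.

Definition bw_rel := [rel u v : arrow Q | (turnB u == v) || (turnW u == v)].
Local Notation R := (connect bw_rel).

Lemma bw_sym u v : R u v = R v u.
Proof.
suff {u v} H u v : R u v -> R v u by apply/idP/idP; apply: H.
case/connectP=> p + ->; elim: p u => [|w p IH] u /=; first by rewrite connect0.
case/andP=> uw /IH wu; apply: connect_trans wu _.
case/orP: uw => /eqP <-.
  have : fconnect turnB (turnB u) u by rewrite (fconnect_sym turnB_inj) fconnect1.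
  by apply: connect_sub => a b /eqP <-; apply: connect1; rewrite /= eqxx.
have : fconnect turnW (turnW u) u by rewrite (fconnect_sym turnW_inj) fconnect1.
by apply: connect_sub => a b /eqP <-; apply: connect1; rewrite /= eqxx orbT.
Qed.

Lemma bwB u : R u (turnB u). Proof. by apply: connect1; rewrite /= eqxx. Qed.
Lemma bwW u : R u (turnW u). Proof. by apply: connect1; rewrite /= eqxx orbT. Qed.

Lemma bwB_arrow_of c (x y z : nat) : (x + y + z = n)%N ->
  R (arrow_of (c, (x, y, z))) (arrow_of (cnext c, (y, z, x))).
Proof. by move=> s; have := bwB (arrow_of (c, (x, y, z))); rewrite /turnB arrow_ofK. Qed.

(** A white turn followed by a black one moves the black triangle one step towards
    the corner c. *)
Lemma bw_shift c (x y z : nat) : (x + y + z = n)%N ->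
  R (arrow_of (c, (x, y, z))) (arrow_of (c, (x + z, y, 0)%N)).
Proof.
elim: z x => [|z IH] x s; first by rewrite addn0 connect0.
have : R (arrow_of (c, (x, y, z.+1))) (arrow_of (cprev c, (z, x.+1, y))).
  by have := bwW (arrow_of (c, (x, y, z.+1))); rewrite /turnW arrow_ofK.
move/connect_trans; apply; have := @bwB_arrow_of (cprev c) z x.+1 y.
rewrite cprevK => h; apply: connect_trans (h _) _; first by lia.
by rewrite -addSnnS; apply: IH; lia.
Qed.

(** Moves towards c, and towards the next corner after rotating the coordinates,
    lead to the black triangle at the corner c. *)
Lemma bw_corner c (x y z : nat) : (x + y + z = n)%N ->
  R (arrow_of (c, (x, y, z))) (arrow_of (c, (n, 0, 0)%N)).
Proof.
move=> s; apply: connect_trans (bw_shift _ s) _.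
apply: connect_trans (bwB_arrow_of _ _) _; first by lia.
apply: connect_trans (bwB_arrow_of _ _) _; first by lia.
apply: connect_trans (bw_shift _ _) _; first by lia.
apply: connect_trans (bwB_arrow_of _ _) _; first by lia.
apply: connect_trans (bw_shift _ _) _; first by lia.
by rewrite cnextS cnextK; have -> : (x + z + (0 + y) = n)%N by lia.
Qed.

Local Notation K c := (arrow_of (c, (n, 0, 0)%N)).

Lemma bw_next c : R (K c) (K (cnext c)).
Proof.
apply: connect_trans (bwB_arrow_of _ _) _; first by lia.
by apply: bw_corner; lia.
Qed.

Lemma bw_cross c : R (K c) (K (ccross c)).
Proof. by have := bwW (K c); rewrite /turnW arrow_ofK // /csum /= !addn0. Qed.

Lemma bw_triangle c c' : c.1 = c'.1 -> R (K c) (K c').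
Proof.
case: c c' => t i [_ j] /= <-; have [->|->|->] := ord3P i j.
- exact: connect0.
- exact: (bw_next (t, i)).
- rewrite bw_sym; have := bw_next (t, ord_pred i).
  by rewrite /cnext /= ord_predK.
Qed.

Lemma bw_connected u v : R u v.
Proof.
suff H c c' : R (K c) (K c').
  have toK w : R w (K (coord_of w).1).
    rewrite -{1}[w]coord_ofK; have := coord_sum w.
    by case: (coord_of w) => [c [[x y] z]]; exact: bw_corner.
  by apply: connect_trans (toK u) _; rewrite bw_sym (connect_trans (toK v)).
have /connectP[p] := Tconn c.1 c'.1; elim: p c => [|t p IH] c /=.
  by move=> _ /esym/bw_triangle.
case/andP=> /existsP[i /existsP[j /eqP g]] pp e.
apply: connect_trans (@bw_triangle c (c.1, ordS i) erefl) _.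
apply: connect_trans (bw_cross _) _.
have ct : (ccross (c.1, ordS i)).1 = t by rewrite /ccross /= ordSK g.
by apply: IH; rewrite ct.
Qed.

(** * Discs around punctures *)

(** The coordinate of a black triangle at the puncture P, zero if its triangle of
    the surface has no corner at P. *)
Definition depth (P : tcorner) a : nat :=
  let: (c, (x, y, z)) := a in
  (if puncture c == P then x else 0) + (if puncture (cnext c) == P then y else 0)
  + (if puncture (cprev c) == P then z else 0).

(** The disc inside the circle around P with coordinate l: its black triangles have
    coordinate above l at P, its white faces likewise.  The label of the white
    face beside an arrow exceeds that of the black triangle by one at the corner
    around which the arrow turns. *)
Definition discB P (l : nat) : pred (arrow Q) := fun u => (l < depth P (coord_of u))%N.
Definition discW P (l : nat) : pred (arrow Q) :=
  fun u => (l < depth P (coord_of u) + (puncture (center u) == P))%N.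
Definition circleS P (l : nat) : pred (arrow Q) :=
  fun u => (puncture (center u) == P) && ((coord_of u).2.1.1 == l).

Lemma closed_turn (f : arrow Q -> arrow Q) (a : pred (arrow Q)) :
  (forall u, a (f u) = a u) -> fclosed f a.
Proof. by move=> H u v /eqP <-; rewrite -[LHS]/(a u) -H. Qed.

Lemma discB_closed P l : fclosed turnB (discB P l).
Proof.
apply: closed_turn => u; rewrite /discB co_turnB.
case: (coord_of u) => [c [[x y] z]]; rewrite /= cnextS cnextK.
by congr (_ < _)%N; lia.
Qed.

Lemma discW_closed P l : fclosed turnW (discW P l).
Proof.
apply: closed_turn => u; rewrite /discW -![center _]/((coord_of _).1) co_turnW.
case: (coord_of u) => [c [[x y] [|z]]] /=; congr (_ < _)%N.
  have -> : puncture (cprev (ccross c)) = puncture (cnext c).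
    by rewrite -puncture_cross ccross_quad.
  by rewrite puncture_cross; do 4 case: (_ == P); lia.
rewrite cprevK cprevP.
by do 3 case: (_ == P); lia.
Qed.

(** Every arrow in the disc is on one black and one white face of the disc, except
    the arrows of the bounding circle, whose black face is outside. *)
Lemma disc_split P l u :
  discW P l u = discB P l u || circleS P l u /\ ~~ (discB P l u && circleS P l u).
Proof.
rewrite /discB /discW /circleS -![center _]/((coord_of _).1).
case: (coord_of u) => [c [[x y] z]] /=.
have [e|_] := eqVneq (puncture c) P; last by rewrite addn0 orbF andbF.
have -> : (puncture (cnext c) == P) = false by apply/eqP; rewrite -e; exact: puncture_next.
have -> : (puncture (cprev c) == P) = false by apply/eqP; rewrite -e; exact: puncture_prev.
by rewrite !addn0; split; [case: (ltngtP x l); lia | case: (ltngtP x l)].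
Qed.

Lemma disc_prod (k : fieldType) (lam : arrow Q -> k) P l :
  \prod_(u | discW P l u) lam u =
  (\prod_(u | discB P l u) lam u) * \prod_(u | circleS P l u) lam u.
Proof.
rewrite (bigID (discB P l)) /=; congr (_ * _); apply: eq_bigl => u;
  by have [-> ] := disc_split P l u; case: (discB P l u); case: (circleS P l u).
Qed.

(** * Monomial invariants of primitive potentials *)
Definition puncture_rep := {c : tcorner | froots (@corner_rot T) c}.
Implicit Type q : puncture_rep * 'I_n.

(** Taking z > 0 here makes the white and straight turns differ at this arrow;
    circles with coordinate l = n are left out because they bound white faces. *)
Definition circ_arrow q : arrow Q := arrow_of (val q.1, (q.2 : nat, 0, n - q.2)%N).
Definition circ_class q : cyc_class Q := orbit_class ruleS (circ_arrow q).

Lemma co_circ q : coord_of (circ_arrow q) = (val q.1, (q.2 : nat, 0, n - q.2)%N).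
Proof. by rewrite arrow_ofK // /csum /=; have := ltn_ord q.2; lia. Qed.

Lemma puncture_repE (P : puncture_rep) : puncture (val P) = val P.
Proof. exact/eqP/(valP P). Qed.

Lemma circ_orbit q u : fconnect turnS (circ_arrow q) u = circleS (val q.1) q.2 u.
Proof.
rewrite /circleS -[center u]/((coord_of u).1); apply/idP/andP => [/circ_inv_orbit|[/eqP e1 /eqP e2]].
  rewrite co_circ => e; split.
    by rewrite (congr1 fst e : puncture (coord_of u).1 = puncture (val q.1)) puncture_repE.
  exact/eqP/(congr1 snd e).
apply: turnS_circle; last by rewrite co_circ.
by rewrite -[center u]/((coord_of u).1) e1 -[center _]/((coord_of (circ_arrow q)).1) co_circ puncture_repE.
Qed.

Lemma circ_class_cover u : ((coord_of u).2.1.1 < n)%N ->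
  exists q, orbit_class ruleS u = circ_class q.
Proof.
move=> ln; have rP : froots (@corner_rot T) (puncture (center u)).
  exact: (roots_root (fconnect_sym (@corner_rot_inj T))).
exists (Sub (puncture (center u)) rP, Ordinal ln).
by apply/esym/eq_orbit_class; rewrite circ_orbit /circleS /= !eqxx.
Qed.

Lemma black_white_neq u v : orbit_class ruleB u <> orbit_class ruleW v.
Proof.
move/orbit_class_inj => [_ /(congr1 coord_of)]; rewrite co_turnB co_turnW.
case: (coord_of u) => [c [[x y] [|z]]] /=; stepEntra.
Qed.

Lemma black_circ_neq u q : orbit_class ruleB u <> circ_class q.
Proof.
move/orbit_class_inj => [_ /(congr1 coord_of)]; rewrite co_turnB co_turnS.
case: (coord_of u) => [c [[x y] [|z]]] /=; stepEntra.
Qed.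

Lemma white_circ_neq u q : orbit_class ruleW u <> circ_class q.
Proof.
move/esym/orbit_class_inj => [_ /(congr1 coord_of)]; rewrite co_turnW co_turnS co_circ.
have := ltn_ord q.2; rewrite -subn_gt0; case: (n - q.2)%N => //= z _.
stepEntra.
Qed.

Lemma circ_class_inj : injective circ_class.
Proof.
move=> q q' /orbit_class_inj[+ _].
rewrite circ_orbit /circleS -[center _]/((coord_of _).1) co_circ /= puncture_repE.
case: q q' => [P l] [P' l'] /= /andP[/eqP e /eqP e'].
by congr pair; apply: val_inj.
Qed.

Lemma black_class_eq u v :
  (orbit_class ruleB u == orbit_class ruleB v) = fconnect turnB u v.
Proof.
apply/eqP/idP => [/esym/orbit_class_inj[]|] //; exact: (@eq_orbit_class _ ruleB).
Qed.

Definition face_monomial (aB aW : pred (arrow Q)) : monomial Q :=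
  [seq (orbit_class ruleB u, 1 : int) | u <- enum [pred u | froots turnB u && aB u]] ++
  [seq (orbit_class ruleW u, -1 : int) | u <- enum [pred u | froots turnW u && aW u]].

Definition torus_index : finType := option (puncture_rep * 'I_n).

Definition orbit_monomial (j : torus_index) : monomial Q :=
  if j is Some q then
    (circ_class q, 1 : int) ::
      face_monomial (discB (val q.1) q.2) (discW (val q.1) q.2)
  else face_monomial predT predT.

Lemma card_torus_index :
  #|torus_index| = (n * fcard (@corner_rot T) predT + 1)%N.
Proof.
rewrite card_option card_prod card_ord card_sig mulnC addn1.
by congr (_ * _).+1; apply: eq_card => c; rewrite !inE andbT.
Qed.

Lemma orbit_monomial_chordless j :
  all (fun e => class_chordless e.1) (orbit_monomial j).
Proof.
have H aB aW : all (fun e => class_chordless e.1) (face_monomial aB aW).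
  rewrite /face_monomial all_cat !all_map; apply/andP; split; apply/allP => u _ /=.
    exact: black_chordless.
  exact: white_chordless.
by case: j => [q|] /=; rewrite H // circle_chordless.
Qed.

(** * The invariants separate orbits *)
Section Field.
Variable k : fieldType.
Implicit Types (W : potential k Q) (lam : arrow Q -> k).

Lemma face_monomialE aB aW W :
  monomial_val (face_monomial aB aW) W =
  (\prod_(u | froots turnB u && aB u) W (orbit_class ruleB u)) *
  \prod_(u | froots turnW u && aW u) (W (orbit_class ruleW u))^-1.
Proof.
by rewrite /monomial_val big_cat !big_map !big_enum.
Qed.

Lemma rescale_orbits (f : turn_rule Q) (a : pred (arrow Q)) lam W W' :
  (forall C, class_chordless C -> W' C = class_weight lam C * W C) ->
  (forall u, class_chordless (orbit_class f u)) -> fclosed f a ->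
  \prod_(u | froots f u && a u) W' (orbit_class f u) =
  (\prod_(u | a u) lam u) * \prod_(u | froots f u && a u) W (orbit_class f u).
Proof.
move=> e ch acl; rewrite -(orbit_prod_froots lam (@turn_inj _ f) acl) -big_split.
by apply: eq_bigr => u _; rewrite e // orbit_class_weight.
Qed.

Lemma face_monomial_rescale aB aW lam W W' :
  (forall C, class_chordless C -> W' C = class_weight lam C * W C) ->
  fclosed turnB aB -> fclosed turnW aW ->
  monomial_val (face_monomial aB aW) W' =
  (\prod_(u | aB u) lam u) / (\prod_(u | aW u) lam u) *
  monomial_val (face_monomial aB aW) W.
Proof.
move=> e cB cW; rewrite !face_monomialE !prodfV.
rewrite (rescale_orbits (f := ruleB) e black_chordless cB).
rewrite (rescale_orbits (f := ruleW) e white_chordless cW).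
by rewrite invfM mulrACA.
Qed.

(** The weights of faces multiply to 1 over the whole surface, and over a disc
    they cancel the weight of the bounding circle. *)
Lemma orbit_monomial_rescale lam W W' j : (forall u, lam u != 0) ->
  (forall C, class_chordless C -> W' C = class_weight lam C * W C) ->
  monomial_val (orbit_monomial j) W' = monomial_val (orbit_monomial j) W.
Proof.
move=> lam0 e; have p0 (a : pred (arrow Q)) : \prod_(u | a u) lam u != 0.
  by apply/prodf_neq0.
case: j => [q|] /=; last first.
  by rewrite (face_monomial_rescale e) // divff ?mul1r.
rewrite /monomial_val !big_cons -/(monomial_val _ W) -/(monomial_val _ W') !expr1z.
rewrite (face_monomial_rescale e (@discB_closed _ _) (@discW_closed _ _)).
rewrite e; last exact: circle_chordless.
rewrite orbit_class_weight orbit_prodE (eq_bigl _ _ (circ_orbit q)) disc_prod.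
by rewrite /= mulrACA invfM mulVKf // divff ?mul1r.
Qed.

(** Arrow scalars lam are chosen to match all face coefficients.  Then lam . W and
    W' agree on faces, and the disc invariants force them to agree on circles. *)
Lemma orbit_monomial_separates W W' : primitive W -> primitive W' ->
  (forall j, monomial_val (orbit_monomial j) W = monomial_val (orbit_monomial j) W') ->
  exists2 lam : arrow Q -> k, forall u, lam u != 0
    & forall C, class_chordless C -> W' C = class_weight lam C * W C.
Proof.
move=> prW prW' FE.
have W0 C : class_chordless C -> W C != 0 by rewrite prW.
have W'0 C : class_chordless C -> W' C != 0 by rewrite prW'.
have [lam lam0 lamE] : exists2 lam : arrow Q -> k, forall u, lam u != 0 &
    forall u, orbit_prod turnB lam u =
                W' (orbit_class ruleB u) / W (orbit_class ruleB u) /\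
              orbit_prod turnW lam u =
                W' (orbit_class ruleW u) / W (orbit_class ruleW u).
  apply: orbit_prod_solve => [| |u v|u|u|u|u|].
  - exact: turnB_inj.
  - exact: turnW_inj.
  - exact: bw_connected.
  - by rewrite mulf_neq0 ?invr_eq0 ?W0 ?W'0 ?black_chordless.
  - by rewrite mulf_neq0 ?invr_eq0 ?W0 ?W'0 ?white_chordless.
  - by rewrite -(eq_orbit_class (f := ruleB) (fconnect1 _ u)).
  - by rewrite -(eq_orbit_class (f := ruleW) (fconnect1 _ u)).
  have condT (f : turn_rule Q) (G : arrow Q -> k) :
      \prod_(u | froots f u && predT u) G u = \prod_(u | froots f u) G u.
    by apply: eq_bigl => u; rewrite andbT.
  have := FE None; rewrite /= !face_monomialE !prodfV.
  rewrite (condT ruleB (fun u => W (orbit_class ruleB u))).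
  rewrite (condT ruleB (fun u => W' (orbit_class ruleB u))).
  rewrite (condT ruleW (fun u => W (orbit_class ruleW u))).
  rewrite (condT ruleW (fun u => W' (orbit_class ruleW u))).
  rewrite !big_split /= !prodfV.
  have p0 (V : potential k Q) (f : turn_rule Q) : (forall C, class_chordless C -> V C != 0) ->
      (forall u, class_chordless (orbit_class f u)) ->
      \prod_(u | froots f u) V (orbit_class f u) != 0.
    by move=> V0 ch; apply/prodf_neq0 => u _; apply: V0.
  have B0 := p0 _ _ W0 black_chordless.
  have V0 := p0 _ _ W0 white_chordless; have V0' := p0 _ _ W'0 white_chordless.
  move/eqP; rewrite eqr_div // => /eqP e.
  by apply/eqP; rewrite eqr_div // -e mulrC.
have WB0 u : W (orbit_class ruleB u) != 0 := W0 _ (black_chordless u).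
have WW0 u : W (orbit_class ruleW u) != 0 := W0 _ (white_chordless u).
exists lam => // C ch; rewrite -[C]reprK.
have chr : chordless (repr C) by rewrite -class_chordlessE reprK.
have [u [->|->|[-> lu]]] := chordless_class chr.
- by rewrite orbit_class_weight (lamE u).1 (divfK (WB0 u)).
- by rewrite orbit_class_weight (lamE u).2 (divfK (WW0 u)).
have [q ->] := circ_class_cover lu.
rewrite orbit_class_weight orbit_prodE (eq_bigl _ _ (circ_orbit q)).
have lam0p (a : pred (arrow Q)) : \prod_(v | a v) lam v != 0.
  by apply/prodf_neq0.
pose V : potential k Q := fun C => class_weight lam C * W C.
have VE C' : class_chordless C' -> V C' = class_weight lam C' * W C' by [].
have VB v : V (orbit_class ruleB v) = W' (orbit_class ruleB v).
  by rewrite VE ?black_chordless // orbit_class_weight (lamE v).1 (divfK (WB0 v)).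
have VW v : V (orbit_class ruleW v) = W' (orbit_class ruleW v).
  by rewrite VE ?white_chordless // orbit_class_weight (lamE v).2 (divfK (WW0 v)).
have := orbit_monomial_rescale (Some q) lam0 VE; rewrite FE /=.
rewrite /monomial_val !big_cons -/(monomial_val _ V) -/(monomial_val _ W') !expr1z.
have -> : monomial_val (face_monomial (discB (val q.1) q.2) (discW (val q.1) q.2)) V =
          monomial_val (face_monomial (discB (val q.1) q.2) (discW (val q.1) q.2)) W'.
  rewrite !face_monomialE; congr (_ * _); apply: eq_bigr => v _.
    by rewrite VB.
  by rewrite VW.
set F := monomial_val _ W'; have F0 : F != 0.
  rewrite /F face_monomialE prodfV mulf_neq0 ?invr_eq0 //.
    by apply/prodf_neq0 => v _; exact: W'0 (black_chordless v).
  by apply/prodf_neq0 => v _; exact: W'0 (white_chordless v).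
move/(mulIf F0) <-; rewrite /V /circ_class orbit_class_weight orbit_prodE.
by rewrite (eq_bigl _ _ (circ_orbit q)).
Qed.

(** * A monomial section *)
Section MonomialSection.
Variable u0 : arrow Q.

(** The first parameter is put on the black triangle of u0.  Its inverse is put on
    the circles whose disc contains that triangle, so that it cancels in the
    disc invariants. *)
Definition section_exponent (C : cyc_class Q) (j : torus_index) : int :=
  if j is Some q then (if C == circ_class q then 1 else 0)
  else if C == orbit_class ruleB u0 then 1
  else if [exists q, (C == circ_class q) && discB (val q.1) q.2 u0] then -1
  else 0.

Definition section_pot (y : torus_index -> k) : potential k Q :=
  fun C => if class_chordless C then \prod_j y j ^ section_exponent C j else 0.

Lemma prod_option (I : finType) (G : option I -> k) :
  \prod_j G j = G None * \prod_i G (Some i).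
Proof.
rewrite (bigD1 None) //=; congr (_ * _).
rewrite (reindex_omap Some id) => [|[]] //=.
by apply: eq_bigl => i; rewrite eqxx.
Qed.

Lemma section_white y u : section_pot y (orbit_class ruleW u) = 1.
Proof.
rewrite /section_pot white_chordless prod_option /= [_ == _](introF eqP (nesym (@black_white_neq _ _))).
rewrite (introF existsP) => [|[q /andP[/eqP/white_circ_neq]]] //.
rewrite expr0z mul1r big1 // => q _; case: eqP => [/white_circ_neq //|_].
exact: expr0z.
Qed.

Lemma section_black y u : section_pot y (orbit_class ruleB u) =
  if fconnect turnB u u0 then y None else 1.
Proof.
rewrite /section_pot black_chordless prod_option /= black_class_eq.
rewrite [X in _ * X]big1 ?mulr1 => [|q _]; last first.
  by case: eqP => [/black_circ_neq //|_]; apply: expr0z.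
case: ifP => _; first exact: expr1z.
rewrite (introF existsP) => [|[q /andP[/eqP/black_circ_neq]]] //.
Qed.

Lemma section_circ y q : section_pot y (circ_class q) =
  (if discB (val q.1) q.2 u0 then (y None)^-1 else 1) * y (Some q).
Proof.
rewrite /section_pot circle_chordless prod_option /= [_ == _](introF eqP (nesym (@black_circ_neq _ _))).
congr (_ * _); last first.
  rewrite (bigD1 q) //= eqxx expr1z big1 ?mulr1 // => q' ne.
  by rewrite (inj_eq circ_class_inj) eq_sym (negPf ne) expr0z.
have -> : [exists q', (circ_class q == circ_class q') && discB (val q'.1) q'.2 u0] =
          discB (val q.1) q.2 u0.
  apply/existsP/idP => [[q' /andP[/eqP/circ_class_inj <-]] //|d].
  by exists q; rewrite eqxx.
by case: ifP.
Qed.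

Lemma section_face y (aB aW : pred (arrow Q)) : fclosed turnB aB ->
  monomial_val (face_monomial aB aW) (section_pot y) = if aB u0 then y None else 1.
Proof.
move=> cB; have sB := fconnect_sym turnB_inj.
rewrite face_monomialE [X in _ * X]big1 ?mulr1 => [|u _]; last by rewrite section_white invr1.
rewrite (eq_bigr _ (fun u _ => section_black y u)) -big_mkcondr.
have rE u : froots turnB u -> fconnect turnB u u0 = (u == froot turnB u0).
  by move=> /eqP ru; rewrite -(root_connect sB) ru.
have aE : aB (froot turnB u0) = aB u0 := esym (closed_connect cB (connect_root _ u0)).
case: ifP => a0.
  rewrite (big_pred1 (froot turnB u0)) // => u /=.
  apply/andP/eqP => [[/andP[ru _]]|->]; first by rewrite rE // => /eqP.
  rewrite aE a0 (roots_root sB); split=> //.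
  by rewrite sB connect_root.
rewrite big_pred0 // => u; apply/negP => /andP[/andP[ru au]].
by rewrite rE // => /eqP e; rewrite e aE a0 in au.
Qed.

Lemma section_potK (y : torus_index -> k) j : (forall j, y j != 0) ->
  monomial_val (orbit_monomial j) (section_pot y) = y j.
Proof.
move=> y0; case: j => [q|] /=; last by rewrite section_face.
rewrite /monomial_val big_cons -/(monomial_val _ _) expr1z section_circ.
rewrite section_face; last exact: discB_closed.
by case: ifP; rewrite ?mulr1 ?mul1r // mulrAC mulVf ?mul1r.
Qed.

End MonomialSection.
End Field.
End Connectivity.
End Coordinates.

(** * The quotient torus *)
Lemma torus_criterion (k : fieldType) (Q : quiver) (J : finType)
    (F : J -> monomial Q) (S : cyc_class Q -> J -> int) :
  (forall j, all (fun e => class_chordless e.1) (F j)) ->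
  (forall W W' : potential k Q, primitive W -> primitive W' ->
     same_orbit W W' <-> forall j, monomial_val (F j) W = monomial_val (F j) W') ->
  (forall y : J -> k, (forall j, y j != 0) -> forall j, monomial_val (F j)
     (fun C => if class_chordless C then \prod_i y i ^ S C i else 0) = y j) ->
  primitive_quotient_isom_torus k Q #|J|.
Proof.
move=> ch sep sec.
exists (fun j => F (enum_val j)), (fun C j => S C (enum_val j)); split=> //.
  move=> W W' pW pW'; rewrite (sep _ _ pW pW'); split=> e j //.
  by rewrite -[j]enum_rankK.
move=> y y0 j; pose y' i := y (enum_rank i).
rewrite -[RHS]/(y j) -{2}[j]enum_valK -[RHS]/(y' (enum_val j)) -sec => [|i]; last exact: y0.
congr monomial_val; apply: funext => C; rewrite /monomial_pot; case: ifP => // _.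
rewrite [RHS](reindex _ (onW_bij _ (@enum_val_bij J))).
by apply: eq_bigr => i _; rewrite /y' enum_valK.
Qed.

Theorem theorem1p1 (k : fieldType) (m g d : nat) (T : triangle_gluing) :
  [pchar k] =i pred0 ->
  (1 <= m)%N -> (0 < d)%N -> (2 < 2 * g + d)%N ->
  triangulated_surface T g d -> no_loop_arcs T -> valence_ge3 T ->
  let Q := surface_quiver T m in
  primitive_quotient_isom_torus k Q ((m - 1) * d + 1)%N
  /\ forall (phi : cpath_alg k Q -> cpath_alg k Q) (W : potential k Q),
       right_equivalence phi -> generic W ->
       prim_part (pot_act phi W) = prim_part (pot_act phi (prim_part W)).
Proof.
move=> _ m1 d0 _ [Tconn Tpts _] nl v3.
case: m m1 => // n _ Q.
have noloop := surface_noloop (n := n) nl v3.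
have nopar := surface_noparallel (n := n) nl v3.
split; last first.
  move=> phi W phiP _; apply: funext => C; rewrite /prim_part.
  case: ifP => // ch; rewrite !(pot_act_chordless _ noloop nopar phiP ch).
  by rewrite ch.
have [c0 _] : exists c0, c0 \in predI (froots (@corner_rot T)) predT.
  by apply/card_gt0P; move: d0; rewrite -Tpts.
pose u0 : arrow Q := arrow_of n (c0, (n, 0, 0)%N).
have -> : ((n.+1 - 1) * d + 1)%N = #|torus_index T n|.
  by rewrite card_torus_index Tpts subn1.
apply: (torus_criterion (F := @orbit_monomial T n) (S := @section_exponent T n u0)).
- exact: orbit_monomial_chordless.
- move=> W W' pW pW'; rewrite same_orbit_weight //; last first.
    move=> a; exists (orbit_class (ruleB T n) a).
      exact: black_chordless.
    by rewrite mem_orbit_class connect0.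
  split=> [[lam lam0 e] j|]; last exact: orbit_monomial_separates.
  by symmetry; apply: orbit_monomial_rescale e.
- by move=> y y0 j; apply: section_potK.
Qed.
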